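(* Let $k,r,l$ be positive integers with $p\nmid rl$, $p\mid(r+l+k)$ and $\bar r+\bar l\le p$, where $\bar r,\bar l\in\{0,\dots,p-1\}$ are the residues of $r,l$ modulo $p$. Let $t\in K$ be such that there exists $\tau\in\mathcal{O}_K^\times$ with $\tau^p=t$ (written $t^{1/p}\in\mathcal{O}_K^\times$). Let $$f(x,y,z)=x^p+y^rz^l\sum_{i=0}^{k}\binom{k+r}{i+r}y^i(tz-y)^{k-i}\in K[x,y,z]$$ (binomial coefficients taken in the prime field of $K$). Let $\chi$ be a multiplicative character of $\mathcal{O}_K^\times$. Then $Z_f(s,\chi)$ is a rational function of $q^{-s}$, and moreover, for $\mathrm{Re}(s)>0$: (1) If $p\mid\binom{k+r}{r}$, then $Z_f(s,\chi)=\dfrac{1-q^{-1}}{1-q^{-1-ps}}$ if $\chi^p$ is the trivial character, and $Z_f(s,\chi)=0$ otherwise. (2) If $p\nmid\binom{k+r}{r}$, then there is a polynomial $F(x)\in\mathbb{C}[x]$ with $$Z_f(s,\chi)=\frac{F(q^{-s})}{(1-q^{-1-s})\bigl(1-q^{-((k+l+r)/p+2)-(k+l+r)s}\bigr)\prod_{a\in\{r,l,k+1\}}(1-q^{-p-a-pas})}.$$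
   Context: $K$ is a non-archimedean local field of characteristic $p>0$ ($p$ prime), $\mathcal{O}_K$ its ring of integers, $\pi$ a uniformizer, $\mathcal{O}_K^\times$ the unit group, $q$ the cardinality of the residue field. For $x\in K^\times$, $\mathrm{ord}(x)$ is the valuation with $\mathrm{ord}(\pi)=1$, $x=ac(x)\pi^{\mathrm{ord}(x)}$ with $ac(x)\in\mathcal{O}_K^\times$, and $|x|=q^{-\mathrm{ord}(x)}$. $|dx|$ is the Haar measure on $K^n$ with $\mathcal{O}_K^n$ of measure $1$. For a character $\chi:\mathcal{O}_K^\times\to\mathbb{C}^\times$ set $\chi(ac(0)):=0$. For $f\in\mathcal{O}_K[x_1,\dots,x_n]$ non-constant and $\mathrm{Re}(s)>0$, $Z_f(s,\chi)=\int_{\mathcal{O}_K^n}\chi(ac\, f(x))|f(x)|^s|dx|$. The polynomial $f$ in the statement is called a hybrid polynomial (Hauser). *)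

(* Defs.v *)
From HB Require Import structures.
From mathcomp Require Import all_boot all_order all_algebra.
From mathcomp Require Import finmap complex.
From mathcomp Require Import all_classical all_reals all_analysis.

Set Implicit Arguments.
Unset Strict Implicit.
Unset Printing Implicit Defensive.

Import Order.TTheory GRing.Theory Num.Theory.
Import numFieldNormedType.Exports.

Local Open Scope classical_set_scope.
Local Open Scope ring_scope.

(* The value of [v] at 0 is never used, so that [v] stands for a valuation with
   v(0) = +oo; [vball v a N] is the coset a + {x | v(x) >= N}. *)
Definition vball (K : fieldType) (v : K -> int) (a : K) (N : int) : set K :=
  [set x | x = a \/ N <= v (x - a)].

(* Non-archimedean local field: a field complete with respect to a normalized
   discrete valuation, with finite residue field, and with the topology of the
   valuation. The residue field is the set of the cosets a + m of the maximal
   ideal m = {x | v(x) >= 1} in the valuation ring. *)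
HB.mixin Record isLocalField K & GRing.Field K & Topological K := {
  ord : K -> int ;
  ordM : forall x y : K, x != 0 -> y != 0 -> ord (x * y) = ord x + ord y ;
  ord_ultra : forall x y : K, x != 0 -> y != 0 -> x + y != 0 ->
    Num.min (ord x) (ord y) <= ord (x + y) ;
  ord_normalized : exists x : K, x != 0 /\ ord x = 1 ;
  nbhs_ordE : forall (x : K) (A : set K),
    nbhs x A <-> exists N : int, vball ord x N `<=` A ;
  ord_complete : forall u : nat -> K,
    (forall M : int, exists N : nat, forall m n : nat,
       (N <= m)%N -> (N <= n)%N -> vball ord (u n) M (u m)) ->
    exists l : K, u @ \oo --> l ;
  residue_finite : finite_set [set vball ord a 1 | a in vball ord 0 0]
}.

#[short(type="localFieldType")]
HB.structure Definition LocalField :=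
  {K of GRing.Field K & Topological K & isLocalField K}.

Section LocalFieldDefs.
Variable K : localFieldType.

Definition integers : set K := vball ord 0 0.

Definition units : set K := [set x | x != 0 /\ ord x = 0].

Definition uniformizer (x : K) : Prop := x != 0 /\ ord x = 1.

Definition residue_field : set (set K) := [set vball ord a 1 | a in integers].

Definition residue_card : nat := #|` fset_set residue_field|%N.

Definition ac (pi x : K) : K := x / pi ^ ord x.

Definition absK (R : realType) (x : K) : R :=
  if x == 0 then 0 else residue_card%:R ^ (- ord x).

Definition integers3 : set (K * K * K) :=
  [set w | [/\ integers w.1.1, integers w.1.2 & integers w.2]].

(* The measurable structure on [g_sigma_algebraType] requires a pointed type;
   [K3] is only there to carry the base point. *)
Definition K3 : Type := (K * K * K)%type.
HB.instance Definition _ := Choice.on K3.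
HB.instance Definition _ := isPointed.Build K3 (0 : K * K * K).

(* K^3 with its Borel sigma-algebra for the product topology. *)
Definition borelK3 := g_sigma_algebraType (@open (K * K * K)%type : set (set K3)).

(* Finiteness on compact sets follows from invariance and normalization, and
   regularity is automatic because K^3 is second countable. *)
Definition normalized_haar (R : realType) (mu : {measure set borelK3 -> \bar R}) :
    Prop :=
  (forall (a : K * K * K) (A : set borelK3), measurable A ->
     mu [set (a + w : K * K * K) | w in (A : set (K * K * K))] = mu A) /\
  mu integers3 = 1%E.

(* Characters are continuous; the values of [chi] outside of the unit group are
   irrelevant. *)
Definition mult_char (R : realType) (chi : K -> R[i]) : Prop :=
  [/\ forall u, units u -> chi u != 0,
      forall u v, units u -> units v -> chi (u * v) = chi u * chi v
    & {within units, continuous (chi : K -> (R[i] : numFieldType))}].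

Definition chi_ac (R : realType) (pi : K) (chi : K -> R[i]) (x : K) : R[i] :=
  if x == 0 then 0 else chi (ac pi x).

End LocalFieldDefs.
Arguments absK {K} R x.
Arguments integers K : clear implicits.
Arguments units K : clear implicits.
Arguments residue_field K : clear implicits.
Arguments residue_card K : clear implicits.
Arguments integers3 K : clear implicits.
Arguments borelK3 K : clear implicits.

Section ComplexAnalysis.
Variable R : realType.

Definition expC (z : R[i]) : R[i] :=
  Complex (expR (complex.Re z) * cos (complex.Im z)) (expR (complex.Re z) * sin (complex.Im z)).

(* a ^ s for a real a >= 0, with 0 ^ s = 0. *)
Definition powC (a : R) (s : R[i]) : R[i] :=
  if a == 0 then 0 else expC (s * (ln a)%:C%C).

Definition Cintegral d (T : measurableType d) (mu : {measure set T -> \bar R})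
    (D : set T) (g : T -> R[i]) : R[i] :=
  Complex (\int[mu]_(w in D) complex.Re (g w))%R (\int[mu]_(w in D) complex.Im (g w))%R.

(* On Re(s) > 0 the variable b^-s ranges over 0 < |T| < 1 (b > 1), where the
   rational function P / Q has no pole. *)
Definition rational_in_powC (b : R) (Z : R[i] -> R[i]) : Prop :=
  exists P Q : {poly R[i]}, forall s : R[i], 0 < complex.Re s ->
    Q.[powC b (- s)] != 0 /\ Z s = P.[powC b (- s)] / Q.[powC b (- s)].

End ComplexAnalysis.

Definition zeta3 (R : realType) (K : localFieldType)
    (mu : {measure set (borelK3 K) -> \bar R}) (pi : K) (f : K -> K -> K -> K)
    (chi : K -> R[i]) (s : R[i]) : R[i] :=
  Cintegral mu (integers3 K) (fun w : K * K * K =>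
    chi_ac pi chi (f w.1.1 w.1.2 w.2) * powC (absK R (f w.1.1 w.1.2 w.2)) s).

Definition hybrid (K : fieldType) (p k r l : nat) (t x y z : K) : K :=
  x ^+ p + y ^+ r * z ^+ l *
    \sum_(0 <= i < k.+1) 'C(k + r, i + r)%:R * y ^+ i * (t * z - y) ^+ (k - i).

(* Main.v *)
Require Import Defs.
From HB Require Import structures.
From mathcomp Require Import all_boot all_order all_algebra.
From mathcomp Require Import finmap complex.
From mathcomp Require Import all_classical all_reals all_analysis measurable_realfun.
From mathcomp Require Import ring zify.

Import Order.TTheory GRing.Theory Num.Theory.
Import numFieldNormedType.Exports.

Set Implicit Arguments.
Unset Strict Implicit.
Unset Printing Implicit Defensive.

Local Open Scope classical_set_scope.
Local Open Scope ring_scope.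

(** Put [T = q^-s] and expand [Z_f(s,chi) = sum_m c_m T^m], where [c_m] is the
    integral of [chi(ac f)] over [{ord f = m}]. As [chi] is locally constant,
    [c_m] is an average over [(O/pi^n)^3] for [n] large, and a change of
    variables becomes a bijection of a finite set.

    Rescaling [x] and [y] reduces to [t = 1], where [f = x^p + g(y,z)] with [g]
    homogeneous of degree [d = r+l+k], and a telescoping sum gives
    [dg/dy (y,1) = r C(k+r,r) y^(r-1) (1-y)^k]. If [p | C(k+r,r)], then [g] is a
    [p]-th power and a translation of [x] reduces [f] to [x^p]. Otherwise the
    scaling [(pi^(d/p) x, pi y, pi z)] yields the factor
    [1 - q^(-d/p-2) T^d] and leaves the charts [z = 1] and [y = 1]. There [f] is
    smooth in the second variable except at the points [y/z = 0, 1, oo], near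
    which it is, up to a translation of [x], [x^p + u Y^a] with [u] a unit and
    [a = r, k+1, l]. Since [p] does not divide [a], the unit [u] can be made
    constant by a measure preserving change of [Y], and the quasihomogeneity of
    [x^p + c Y^a] yields the factor [1 - q^(-p-a) T^(pa)]. *)

(** * Generating functions *)

(** The derivative of [f] in [x] vanishes identically, so smoothness can only come from [y] or [z],
    and the critical points of [g] in the charts have to be treated whether or not [g] vanishes
    there. The same feature helps: since [x^p + c^p = (x + c)^p], a critical value that is a [p]-th
    power is absorbed by [x]. At [y/z = 1] this value is 1.

    The exponents in the denominators come from Jacobians: [(pi^a x, pi^p Y)] scales the measure by
    [q^-(p+a)] and multiplies [x^p + c Y^a] by [pi^(pa)]. Such a scaling is carried out one variable
    and one factor [pi] at a time. Once the charts are split off, the part discarded at each stage,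
    where that variable is a unit, gives the polynomial a fixed order and affects finitely many
    coefficients. Hence the recursions are needed for large [m] only, and the numerator is left
    unspecified. The contributions of the charts are added, so an exponent occurring twice among
    [r], [l], [k+1] needs its factor only once. *)

Section GeneratingFunctions.
Variable C : numFieldType.
Implicit Types (Q P : {poly C}) (c o : nat -> C).

(* Q(T) * sum_m c_m T^m = P(T) on the open unit disc, with a geometric rate of
   convergence, so that no completeness of C is involved. *)
Definition gf Q P c := forall T : C, `|T| < 1 -> exists B : C, forall n,
  `|Q.[T] * \sum_(m < n) c m * T ^+ m - P.[T]| <= B * `|T| ^+ n.

Definition gfE Q c := exists P, gf Q P c.

Lemma gf_ext Q P c o : c =1 o -> gf Q P c -> gf Q P o.
Proof.
move=> co hP T /hP[B hB]; exists B => n.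
by under eq_bigr do rewrite -co.
Qed.

Lemma gfE_ext Q c o : c =1 o -> gfE Q c -> gfE Q o.
Proof.
by move=> co [P hP]; exists P; apply: gf_ext hP.
Qed.

Lemma gfE_add Q c o : gfE Q c -> gfE Q o -> gfE Q (fun m => c m + o m).
Proof.
move=> [P hP] [P' hP']; exists (P + P') => T T1.
have [B hB] := hP T T1; have [B' hB'] := hP' T T1; exists (B + B') => n.
under eq_bigr do rewrite mulrDl.
rewrite big_split hornerD mulrDr opprD addrACA mulrDl.
by apply: le_trans (ler_normD _ _) (lerD (hB n) (hB' n)).
Qed.

Lemma gf_scale Q P a c : gf Q P c -> gf Q (a *: P) (fun m => a * c m).
Proof.
move=> hP T T1; have [B hB] := hP T T1; exists (`|a| * B) => n.
under eq_bigr do rewrite -mulrA.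
rewrite -mulr_sumr hornerZ mulrCA -mulrBr normrM -mulrA.
by rewrite ler_wpM2l.
Qed.

Lemma gfE_scale Q a c : gfE Q c -> gfE Q (fun m => a * c m).
Proof. by move=> [P hP]; exists (a *: P); apply: gf_scale. Qed.

Lemma gfE_sum Q (I : Type) (s : seq I) (p : pred I) (F : I -> nat -> C) :
  (forall i, p i -> gfE Q (F i)) -> gfE Q (fun m => \sum_(i <- s | p i) F i m).
Proof.
move=> h; elim: s => [|i s IHs].
  exists 0 => T T1; exists 0 => n; rewrite big1 => [|m _].
    by rewrite mulr0 horner0 subrr normr0 mul0r.
  by rewrite big_nil mul0r.
case pi: (p i); last by apply: gfE_ext IHs => m; rewrite big_cons pi.
by apply: gfE_ext (gfE_add (h i pi) IHs) => m; rewrite big_cons pi.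
Qed.

Lemma gfE_mul Q Q' c : gfE Q c -> gfE (Q * Q') c.
Proof.
move=> [P hP]; exists (P * Q') => T T1.
have [B hB] := hP T T1; exists (B * `|Q'.[T]|) => n.
rewrite !hornerM mulrAC -mulrBl normrM mulrAC.
by rewrite ler_wpM2r.
Qed.

Lemma gfE_dvd Q Q' c : gfE Q c -> (exists D, Q' = Q * D) -> gfE Q' c.
Proof. by move=> h [D ->]; apply: gfE_mul. Qed.

(** A partial sum misses only terms of exponent at least [n], each of norm at most [|c m| |T|^n]. *)
Lemma gf_fin n0 c : (forall m, (n0 <= m)%N -> c m = 0) ->
  gf 1 (\poly_(m < n0) c m) c.
Proof.
move=> c0 T T1; exists (\sum_(m < n0) `|c m|) => n.
rewrite hornerC mul1r horner_poly.
have E k : \sum_(m < k) c m * T ^+ m = \sum_(m < n0 | (m < k)%N) c m * T ^+ m.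
  elim: k => [|k IHk]; first by rewrite big_ord0 big_pred0.
  rewrite big_ord_recr IHk /=.
  have [nk|kn] := leqP n0 k.
    rewrite c0 // mul0r addr0; apply: eq_bigl => i.
    by rewrite (leq_trans (ltn_ord i) nk) ltnW // ltnS (leq_trans (ltn_ord i) nk).
  rewrite [RHS](bigD1 (Ordinal kn)) //= addrC; congr (_ + _).
  by apply: eq_bigl => i; rewrite ltnS ltn_neqAle andbC.
rewrite E [X in _ - X](bigID (fun m : 'I_n0 => (m < n)%N)) /= opprD addrA subrr.
rewrite add0r normrN; apply: (le_trans (ler_norm_sum _ _ _)).
rewrite mulr_suml [leRHS](bigID (fun m : 'I_n0 => (m < n)%N)) /=.
apply: ler_wpDl; first by apply: sumr_ge0 => i _; rewrite mulr_ge0 ?exprn_ge0.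
apply: ler_sum => m; rewrite -leqNgt => nm; rewrite normrM normrX ler_wpM2l //.
by rewrite -(subnK nm) exprD ler_piMl ?exprn_ge0 // exprn_ile1 // ltW.
Qed.

Lemma gfE_fin n0 c : (forall m, (n0 <= m)%N -> c m = 0) -> gfE 1 c.
Proof. by move=> c0; exists (\poly_(m < n0) c m); apply: gf_fin. Qed.

(** Changing finitely many coefficients alters only the numerator, so a recursion has to be verified
    only for large [m]. *)
Lemma gfE_eventually Q c o n0 : (forall m, (n0 <= m)%N -> c m = o m) ->
  gfE Q o -> gfE Q c.
Proof.
move=> co ho; apply: (gfE_ext (c := fun m => o m + (c m - o m))).
  by move=> m; rewrite addrC subrK.
apply: gfE_add => //; rewrite -[Q]mul1r; apply: gfE_mul.
by apply: (@gfE_fin n0) => m /co ->; rewrite subrr.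
Qed.

(** Multiplying the series by [1 - l T^a] subtracts a shifted copy, whose partial sum stops at
    [n - a] instead of [n]. The bound on [c] controls the at most [a] terms in between: after
    multiplication by [T^a] each has exponent at least [n]. *)
Lemma gf_rec Q P (l : C) a (B : C) c : (forall m, `|c m| <= B) ->
  gf Q P (fun m => c m - l * (if (a <= m)%N then c (m - a)%N else 0)) ->
  gf (Q * (1 - l *: 'X^a)) P c.
Proof.
move=> cB hP T T1; have [B' hB'] := hP T T1.
exists (B' + `|Q.[T] * l| * (B *+ a)) => n.
have {}hB' := hB' n; move: hB'.
under eq_bigr do rewrite mulrBl.
rewrite sumrB mulrBr => hB'.
have E : \sum_(m < n) l * (if (a <= m)%N then c (m - a)%N else 0) * T ^+ m =
   l * T ^+ a * (\sum_(m < n - a) c m * T ^+ m).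
  have [an|na] := leqP a n; last first.
    rewrite (eqP (ltnW na : n - a == 0)%N) big_ord0 mulr0 big1 // => m _.
    by rewrite leqNgt (ltn_trans (ltn_ord m) na) mulr0 mul0r.
  have E0 k : \sum_(m < a + k) l * (if (a <= m)%N then c (m - a)%N else 0) * T ^+ m =
      l * T ^+ a * (\sum_(m < k) c m * T ^+ m).
    rewrite big_split_ord /= big1 ?add0r => [|m _]; last first.
      by rewrite leqNgt ltn_ord mulr0 mul0r.
    rewrite mulr_sumr; apply: eq_bigr => m _.
    by rewrite leq_addr addKn exprD; ring.
  by have := E0 (n - a)%N; rewrite subnKC.
rewrite E in hB'.
have tail : `|\sum_(m < n) c m * T ^+ m - \sum_(m < n - a) c m * T ^+ m| * `|T| ^+ a
    <= (B *+ a) * `|T| ^+ n.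
  have B0 : 0 <= B by apply: le_trans (cB 0%N).
  have D k j : \sum_(m < k + j) c m * T ^+ m - \sum_(m < k) c m * T ^+ m =
      \sum_(i < j) c (k + i)%N * T ^+ (k + i).
    by rewrite big_split_ord /= addrAC subrr add0r.
  have := D (n - a)%N (n - (n - a))%N; rewrite subnKC ?leq_subr // => ->.
  apply: le_trans (ler_wpM2r (exprn_ge0 _ (normr_ge0 _)) (ler_norm_sum _ _ _)) _.
  rewrite mulr_suml; apply: (@le_trans _ _ (\sum_(i < n - (n - a)) B * `|T| ^+ n)).
    apply: ler_sum => i _; rewrite normrM normrX -mulrA ler_pM ?mulr_ge0 ?exprn_ge0 //.
    rewrite -exprD; have /subnK <- : (n <= n - a + i + a)%N by lia.
    by rewrite exprD ler_piMl ?exprn_ge0 // exprn_ile1 // ltW.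
  rewrite sumr_const card_ord mulrnAl; rewrite ler_wpMn2l ?mulr_ge0 ?exprn_ge0 //; lia.
set S := \sum_(m < n) _ in hB' tail *; set S' := \sum_(m < n - a) _ in hB' tail.
have -> : (Q * (1 - l *: 'X^a)).[T] * S - P.[T] =
    Q.[T] * S - Q.[T] * (l * T ^+ a * S') - P.[T] - Q.[T] * l * ((S - S') * T ^+ a).
  by rewrite hornerM hornerD hornerN hornerZ hornerXn hornerC; ring.
apply: le_trans (ler_normB _ _) _; rewrite [leRHS]mulrDl; apply: lerD => //.
by rewrite normrM -mulrA ler_wpM2l // normrM normrX.
Qed.

Lemma gfE_rec Q (l : C) a (B : C) c : (forall m, `|c m| <= B) ->
  gfE Q (fun m => c m - l * (if (a <= m)%N then c (m - a)%N else 0)) ->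
  gfE (Q * (1 - l *: 'X^a)) c.
Proof. by move=> cB [P hP]; exists P; apply: gf_rec hP. Qed.
End GeneratingFunctions.

(** * Complex powers and geometric convergence *)

Section ComplexPowers.
Variable R : realType.
Local Notation C := R[i].
Implicit Types (z s : C) (a : R).

Lemma expCD z s : expC (z + s) = expC z * expC s.
Proof.
case: z s => [x y] [x' y']; rewrite /expC /= expRD cosD sinD.
by apply/eqP; rewrite eq_complex /=; apply/andP; split; apply/eqP; ring.
Qed.

Lemma expC_real (x : R) : expC x%:C%C = (expR x)%:C%C.
Proof. by rewrite /expC /= cos0 sin0 mulr1 mulr0. Qed.

Lemma expC0 : expC (0 : C) = 1.
Proof. by rewrite -[0 : C]/((0 : R)%:C)%C expC_real expR0. Qed.

Lemma expC_neq0 z : expC z != 0.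
Proof.
apply/eqP => h; have := expCD z (- z); rewrite subrr expC0 h mul0r => /eqP.
by rewrite oner_eq0.
Qed.

Lemma expCMn n z : expC (n%:R * z) = expC z ^+ n.
Proof.
elim: n => [|n IHn]; first by rewrite mul0r expC0.
by rewrite -natr1 mulrDl mul1r expCD IHn exprSr.
Qed.

Lemma expCN z : expC (- z) = (expC z)^-1.
Proof.
by apply: (mulfI (expC_neq0 z)); rewrite -expCD subrr expC0 divff ?expC_neq0.
Qed.

Lemma norm_expC z : `|expC z| = (expR (complex.Re z))%:C%C.
Proof.
by rewrite normc_def /= !exprMn -mulrDr cos2Dsin2 mulr1 sqrtr_sqr ger0_norm.
Qed.

Lemma powC_monomial (n j m : nat) s : (1 < n)%N ->
  powC (n%:R : R) (- j%:R - m%:R * s) = (n%:R ^+ j)^-1 * powC (n%:R : R) (- s) ^+ m.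
Proof.
move=> n1; have n0 : (n%:R : R) != 0 by rewrite pnatr_eq0 -lt0n ltnW.
rewrite /powC (negPf n0) mulrBl expCD; congr (_ * _).
  rewrite mulNr expCN expCMn expC_real lnK; last by rewrite posrE ltr0n ltnW.
  by rewrite rmorph_nat.
by rewrite -expCMn; congr expC; ring.
Qed.

Lemma norm_powC_lt1 (n : nat) s : (1 < n)%N -> 0 < complex.Re s ->
  `|powC (n%:R : R) (- s)| < 1.
Proof.
move=> n1 s0; have n0 : (n%:R : R) != 0 by rewrite pnatr_eq0 -lt0n ltnW.
rewrite /powC (negPf n0) norm_expC [ltRHS](_ : 1 = (1 : R)%:C%C) // ltcR -[ltRHS]expR0 ltr_expR.
case: s s0 => x y /= x0; rewrite mulr0 subr0 mulNr oppr_lt0 mulr_gt0 //.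
by rewrite ln_gt0 // ltr1n.
Qed.

Lemma eq0_of_geometric_bound (z B T : C) :
  `|T| < 1 -> (forall n, `|z| <= B * `|T| ^+ n) -> z = 0.
Proof.
move=> T1 h; apply/eqP; rewrite -normr_le0.
have toR (x : C) : 0 <= x -> x = (complex.Re x)%:C%C.
  by move=> x0; rewrite RRe_real // ger0_real.
rewrite (toR `|z|) // lecR leNgt; apply/negP => z0.
set rho := complex.Re `|T|.
have TE : `|T| = rho%:C%C by apply: toR.
have rho1 : `|rho| < 1.
  have := T1; rewrite TE [ltRHS](_ : 1 = (1 : R)%:C%C) // ltcR => rho1.
  by rewrite ger0_norm //; have := normr_ge0 T; rewrite TE lecR.
have /cvgrPdist_lt/(_ _ z0)[N _ hN] := cvg_geometric (complex.Re B) rho1.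
have := hN N (leqnn N); rewrite /= sub0r normrN => lt1.
have := h N; rewrite TE -rmorphXn lecE => /andP[_].
have -> : complex.Re (B * (rho ^+ N)%:C%C) = complex.Re B * rho ^+ N.
  by case: (B) => x y /=; rewrite mulr0 subr0.
by move=> le1; have := lt_le_trans lt1 (le_trans le1 (ler_norm _)); rewrite ltxx.
Qed.
End ComplexPowers.

(** * Valuation ring and residue system *)

Section ValuationRing.
Variable K : localFieldType.
Implicit Types x y : K.

Lemma ord1 : ord (1 : K) = 0.
Proof.
have := ordM (1 : K) 1 (oner_neq0 _) (oner_neq0 _).
by rewrite mulr1 => /eqP; rewrite eq_sym -subr_eq0 addrK => /eqP.
Qed.

Lemma ordV x : x != 0 -> ord x^-1 = - ord x.
Proof.
move=> x0; have := ordM x x^-1 x0 (invr_neq0 x0).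
by rewrite divff // ord1 => /eqP; rewrite eq_sym addrC addr_eq0 => /eqP.
Qed.

Lemma ordX x n : x != 0 -> ord (x ^+ n) = ord x *+ n.
Proof.
move=> x0; elim: n => [|n IHn]; first by rewrite expr0 ord1.
by rewrite exprS ordM ?expf_neq0 // IHn mulrS.
Qed.

Lemma ordN1 : ord (-1 : K) = 0.
Proof.
have h : (-1 : K) != 0 by rewrite oppr_eq0 oner_neq0.
by have := ordX 2 h; rewrite sqrrN expr1n ord1 => /eqP;
  rewrite eq_sym mulrn_eq0 => /eqP.
Qed.

Lemma ordN x : ord (- x) = ord x.
Proof.
have [->|x0] := eqVneq x 0; first by rewrite oppr0.
by rewrite -mulN1r ordM ?ordN1 ?add0r // oppr_eq0 oner_neq0.
Qed.

(** A boolean predicate, unlike the set [integers], so that it can carry the closure structures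
    behind the [rpred] lemmas. *)
Definition Oi : {pred K} := [pred x | (x == 0) || (0 <= ord x)].

Lemma Oi_subring : subring_closed Oi.
Proof.
split=> [|x y|x y]; rewrite !inE ?ord1 ?lexx ?orbT //.
- have [->|x0] := eqVneq x 0; first by rewrite sub0r oppr_eq0 ordN.
  have [->|y0] := eqVneq y 0; first by rewrite subr0 (negPf x0).
  have [//|xy0 /= ox oy] := eqVneq (x - y) 0.
  have := ord_ultra x (- y) x0; rewrite oppr_eq0 ordN => /(_ y0 xy0).
  by apply: le_trans; rewrite le_min ox.
- have [->|x0] := eqVneq x 0; first by rewrite mul0r eqxx.
  have [->|y0] := eqVneq y 0; first by rewrite mulr0 eqxx.
  by move=> /= ox oy; rewrite ordM // addr_ge0 ?orbT.
Qed.
HB.instance Definition _ := GRing.isSubringClosed.Build K Oi Oi_subring.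

Lemma integersE x : integers K x <-> x \in Oi.
Proof.
rewrite /integers /vball /= subr0 inE; split=> [[->|->]|/orP[/eqP|]].
- by rewrite eqxx.
- by rewrite orbT.
- by left.
- by right.
Qed.

Definition uO : {pred K} := [pred x | (x != 0) && (ord x == 0)].

Lemma unitsE x : units K x <-> x \in uO.
Proof. by rewrite inE; split=> [[-> ->]|/andP[? /eqP]]. Qed.

Lemma uO_divr : divr_closed uO.
Proof.
split=> [|x y]; first by rewrite inE oner_neq0 ord1.
rewrite !inE => /andP[x0 /eqP ox] /andP[y0 /eqP oy].
by rewrite mulf_neq0 ?invr_neq0 //= ordM ?invr_neq0 // ordV // ox oy.
Qed.
HB.instance Definition _ := GRing.isDivClosed.Build K uO uO_divr.

Lemma uO_neq0 x : x \in uO -> x != 0. Proof. by rewrite inE => /andP[]. Qed.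

Lemma uO_ord x : x \in uO -> ord x = 0.
Proof. by rewrite inE => /andP[_ /eqP]. Qed.

Lemma uO_Oi x : x \in uO -> x \in Oi.
Proof. by rewrite !inE => /andP[_ /eqP ->]; rewrite lexx orbT. Qed.

Lemma uON x : x \in uO -> - x \in uO.
Proof. by rewrite !inE oppr_eq0 ordN. Qed.

Lemma Oi_uO x y : x \in Oi -> y \in Oi -> x * y = 1 -> x \in uO.
Proof.
move=> xO yO xy; have x0 : x != 0.
  by apply: contraPneq xy => ->; rewrite mul0r => /eqP; rewrite eq_sym oner_eq0.
have y0 : y != 0.
  by apply: contraPneq xy => ->; rewrite mulr0 => /eqP; rewrite eq_sym oner_eq0.
move: xO yO; rewrite !inE (negPf x0) (negPf y0) /= => ox oy.
have := ordM x y x0 y0; rewrite xy ord1 => e.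
lia.
Qed.

Lemma Oi_root x n : (0 < n)%N -> x ^+ n \in Oi -> x \in Oi.
Proof.
move=> n0; have [->|x0] := eqVneq x 0; first by rewrite rpred0.
by rewrite !inE expf_eq0 n0 (negPf x0) /= ordX // pmulrn_lge0.
Qed.

(** Bezout gives [a n = 1 + b p], so [n] is inverse in [K] to the image of a natural number, which
    is again integral. *)
Lemma natr_uO p n : p \in [pchar K] -> ~~ (p %| n)%N -> n%:R \in uO.
Proof.
move=> chp npn; have pp := pcharf_prime chp.
have n0 : (0 < n)%N by case: n npn => //; rewrite dvdn0.
have co : coprime n p by rewrite coprime_sym prime_coprime.
have [a b /eqP e _] := egcdnP p n0; move: e; rewrite (eqP co) => /eqP e.
apply: (@Oi_uO _ a%:R); rewrite ?rpred_nat //.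
by rewrite -natrM mulnC e natrD natrM (pcharf0 chp) mulr0 add0r.
Qed.

Section Ideals.
Variables (pi : K) (pi_unif : uniformizer pi).

Let pi0 : pi != 0. Proof. by case: pi_unif. Qed.
Let ordpi : ord pi = 1. Proof. by case: pi_unif. Qed.
Let pX0 n : pi ^+ n != 0. Proof. by rewrite expf_neq0. Qed.

(** The ideal [pi^n O]. Division by [pi ^+ n] puts 0 into it without referring to the meaningless
    value [ord 0]. *)
Definition mI n : {pred K} := [pred x | x / pi ^+ n \in Oi].

Lemma mI_zmod n : zmod_closed (mI n).
Proof.
split=> [|x y xn yn]; first by rewrite -[_ \in _]/(_ \in Oi) mul0r rpred0.
by rewrite -[_ \in _]/(_ \in Oi) mulrBl; apply: rpredB.
Qed.
HB.instance Definition _ n := GRing.isZmodClosed.Build K (mI n) (mI_zmod n).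

Lemma mI0 : mI 0 =i Oi.
Proof. by move=> x; rewrite -[LHS]/(_ \in Oi) expr0 divr1. Qed.

Lemma mIP n x : reflect (exists2 y, y \in Oi & x = pi ^+ n * y) (x \in mI n).
Proof.
apply: (iffP idP) => [h|[y yO ->]].
  by exists (x / pi ^+ n); rewrite // mulrC divfK.
by rewrite -[_ \in _]/(_ \in Oi) mulrAC divff // mul1r.
Qed.

Lemma piO : pi \in Oi. Proof. by rewrite inE ordpi orbT. Qed.

Lemma mI_ord n x : x != 0 -> (x \in mI n) = (n%:Z <= ord x).
Proof.
move=> x0; rewrite -[LHS]/(_ \in Oi) inE mulf_eq0 invr_eq0 (negPf x0) (negPf (pX0 n)) /=.
by rewrite ordM ?invr_neq0 // ordV // ordX // ordpi subr_ge0 natz.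
Qed.

Lemma mI_pi n m x : (pi ^+ n * x \in mI (n + m)) = (x \in mI m).
Proof.
rewrite -[LHS]/(_ \in Oi) -[RHS]/(_ \in Oi) exprD invfM mulrACA divff //.
by rewrite mul1r.
Qed.

Lemma mI_piS m x : (pi * x \in mI m.+1) = (x \in mI m).
Proof. by rewrite -{1}[pi]expr1 -add1n mI_pi. Qed.

Lemma mIM m n x y : x \in mI m -> y \in mI n -> x * y \in mI (m + n).
Proof.
move=> /mIP[a aO ->] /mIP[b bO ->]; apply/mIP; exists (a * b).
  exact: rpredM.
by rewrite exprD; ring.
Qed.

Lemma mIMl n x y : x \in Oi -> y \in mI n -> x * y \in mI n.
Proof. by rewrite -mI0 => xO yn; rewrite -[n]add0n mIM. Qed.

Lemma mIMr n x y : x \in mI n -> y \in Oi -> x * y \in mI n.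
Proof. by move=> xO yn; rewrite mulrC mIMl. Qed.

Lemma mIX n x : pi ^+ n * x \in mI n = (x \in Oi).
Proof. by rewrite -{2}[n]addn0 mI_pi mI0. Qed.

Lemma mI_le m n x : (m <= n)%N -> x \in mI n -> x \in mI m.
Proof.
move=> /subnKC <- /mIP[y yO ->]; apply/mIP; exists (pi ^+ (n - m) * y).
  by rewrite rpredM ?rpredX ?piO.
by rewrite exprD mulrA.
Qed.

Lemma mI_Oi n x : x \in mI n -> x \in Oi.
Proof. by move/(mI_le (leq0n n)); rewrite mI0. Qed.

Lemma mI_uM n u x : u \in uO -> (u * x \in mI n) = (x \in mI n).
Proof.
move=> uu; apply/idP/idP; last by apply: mIMl; apply: uO_Oi.
move=> h; rewrite -[x](mulKf (uO_neq0 uu)) mIMl // uO_Oi //.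
by rewrite rpredV.
Qed.

Lemma uO_notin_mI x : x \in Oi -> (x \in uO) = (x \notin mI 1).
Proof.
have [->|x0] := eqVneq x 0; first by move=> _; rewrite rpred0 inE eqxx.
rewrite mI_ord // !inE x0 (negPf x0) /= -ltNge.
by rewrite -[1%:Z]/(0 + 1 : int) ltzD1 => ox; rewrite eq_le ox andbT.
Qed.

Lemma uO_ndiv x : x \in uO -> x \notin mI 1.
Proof. by move=> h; rewrite -uO_notin_mI // uO_Oi. Qed.

Lemma uO_addl x y : x \in uO -> y \in mI 1 -> x + y \in uO.
Proof.
move=> xu y1; rewrite uO_notin_mI; first by rewrite rpredDr // uO_ndiv.
by rewrite rpredD ?(uO_Oi xu) ?(mI_Oi y1).
Qed.

Lemma uO_congr x y : x - y \in mI 1 -> (x \in uO) = (y \in uO).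
Proof.
move=> h; apply/idP/idP => [xu|yu].
  by rewrite -[y](subKr x) uO_addl // rpredN.
by rewrite -[x](subrK y) addrC uO_addl.
Qed.

Lemma horner_Oi (F : {poly K}) x : F \is a polyOver Oi -> x \in Oi -> F.[x] \in Oi.
Proof. by move=> FO xO; apply: rpred_horner. Qed.

Lemma horner_diff (F : {poly K}) : F \is a polyOver Oi ->
  forall x y, x \in Oi -> y \in Oi ->
  exists2 e, e \in Oi & F.[x] - F.[y] = (x - y) * e.
Proof.
elim/poly_ind: F => [|F c IHF] FO x y xO yO.
  by exists 0; rewrite ?rpred0 // !horner0 subrr mulr0.
have FO' : F \is a polyOver Oi.
  apply/polyOverP => i; have /polyOverP/(_ i.+1) := FO.
  by rewrite coefD coefMX coefC /= addr0.
have [e eO eE] := IHF FO' x y xO yO.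
exists (F.[x] + y * e); first by rewrite rpredD ?rpredM ?horner_Oi.
rewrite !hornerE.
have -> : F.[x] = F.[y] + (x - y) * e by rewrite -eE; ring.
ring.
Qed.

Lemma horner_mI (F : {poly K}) n x y : F \is a polyOver Oi ->
  x \in Oi -> y \in Oi -> x - y \in mI n -> F.[x] - F.[y] \in mI n.
Proof.
move=> FO xO yO xy; have [e eO ->] := horner_diff FO xO yO.
exact: mIMr.
Qed.

Lemma exp_diff a x y : x \in Oi -> y \in Oi ->
  exists2 e, e \in Oi & x ^+ a - y ^+ a = (x - y) * e.
Proof.
move=> xO yO; have := horner_diff (rpredX a (polyOverX Oi)) xO yO.
by rewrite !hornerXn.
Qed.

(** * Approximate roots of units congruent to 1 *)

Section Roots.
Variables (a : nat) (a_unit : (a%:R : K) \in uO).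

(** The quotient is a sum of [a] monomials in [x] and [y], each congruent to 1 modulo [pi]. *)
Lemma exp_diff1 x y : x - 1 \in mI 1 -> y - 1 \in mI 1 ->
  exists2 e, e - a%:R \in mI 1 & x ^+ a - y ^+ a = (x - y) * e.
Proof.
have O1 : 1 \in Oi by rewrite rpred1.
move=> x1 y1; exists (\sum_(i < a) x ^+ (a.-1 - i) * y ^+ i).
  have -> : \sum_(i < a) x ^+ (a.-1 - i) * y ^+ i =
      a%:R + \sum_(i < a) (x ^+ (a.-1 - i) * y ^+ i - 1).
    by rewrite sumrB sumr_const card_ord addrCA subrr addr0.
  rewrite addrAC subrr add0r; apply: rpred_sum => i _.
  have xO : x \in Oi by rewrite -[x](subrK 1) rpredD ?(mI_Oi x1).
  have yO : y \in Oi by rewrite -[y](subrK 1) rpredD ?(mI_Oi y1).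
  have [e eO] := exp_diff (a.-1 - i) xO O1; rewrite expr1n => /eqP.
  rewrite subr_eq => /eqP ->.
  have [f fO] := exp_diff i yO O1; rewrite expr1n => /eqP.
  rewrite subr_eq => /eqP ->.
  rewrite mulrDl mul1r addrA addrK rpredD //.
    by rewrite -!mulrA mIMr // rpredM ?rpredD ?rpredM ?rpredB.
  by rewrite mIMr.
rewrite subrXX.
case: a => [|b]; first by rewrite !big_ord0.
by [].
Qed.

(** Newton iteration with the constant derivative [a]: by [exp_diff1] each step multiplies the error
    by an element of [mI 1]. A root to finite precision is enough, since [phi] depends on finitely
    many digits only. *)
Lemma approx_root u L : u - 1 \in mI 1 ->
  exists2 v, v - 1 \in mI 1 & v ^+ a - u \in mI L.+1.
Proof.
move=> u1; elim: L => [|L [v v1 vu]].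
  by exists 1; [rewrite subrr rpred0 | rewrite expr1n -opprB rpredN].
pose d := (u - v ^+ a) / a%:R.
have dL : d \in mI L.+1.
  rewrite mIMr //; first by rewrite -opprB rpredN.
  by rewrite uO_Oi // rpredV.
have d1 : d \in mI 1 by apply: mI_le dL.
have vd1 : v + d - 1 \in mI 1 by rewrite addrAC rpredD.
exists (v + d) => //.
have [e e1 eE] := exp_diff1 vd1 v1.
have -> : (v + d) ^+ a - u = d * (e - a%:R).
  have -> : (v + d) ^+ a = v ^+ a + (v + d - v) * e by rewrite -eE addrCA subrr addr0.
  by rewrite /d; field; apply: uO_neq0.
by rewrite -[L.+2]addn1 mIM.
Qed.
End Roots.

Definition residue_reps : seq K :=
  [seq xget 0 X | X <- fset_set (residue_field K)].
Local Notation rs := residue_reps.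
Local Notation q := (residue_card K).

Lemma vballE a n x : vball ord a n%:Z x <-> x - a \in mI n.
Proof.
rewrite /vball /=; have [->|xa] := eqVneq x a.
  by rewrite subrr rpred0; split=> // _; left.
rewrite mI_ord ?subr_eq0 //; split=> [[xa'|]//|]; last by right.
by rewrite xa' eqxx in xa.
Qed.

Lemma mem_residue_field X : X \in fset_set (residue_field K) <->
  exists2 a, a \in Oi & X = vball ord a 1.
Proof.
rewrite in_fset_set; last exact: residue_finite.
rewrite inE; split=> [[a /integersE aO <-]|[a /integersE aO ->]].
  by exists a.
by exists a.
Qed.

Lemma vball_eq a b : a - b \in mI 1 -> vball ord a 1 = vball ord b 1.
Proof.
move=> ab; apply/seteqP; split=> x; rewrite !(vballE _ 1) => h.
  by rewrite -[x](subrK a) -addrA rpredD.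
by rewrite -[x](subrK b) -addrA rpredD // -opprB rpredN.
Qed.

Lemma residue_rep X : X \in fset_set (residue_field K) ->
  xget 0 X \in Oi /\ X = vball ord (xget 0 X) 1.
Proof.
move=> /mem_residue_field[a aO XE].
have : X (xget 0 X) by apply: (@xgetPex _ 0 X); exists a; rewrite XE; left.
rewrite {1}XE (vballE a 1) => h; split.
  by rewrite -[xget 0 X](subrK a) rpredD ?(mI_Oi h).
by rewrite {1}XE; apply: vball_eq; rewrite -opprB rpredN.
Qed.

Lemma residue_reps_Oi s : s \in rs -> s \in Oi.
Proof. by move=> /mapP[X /residue_rep[h _] ->]. Qed.

Lemma residue_reps_ex x : x \in Oi -> exists2 s, s \in rs & x - s \in mI 1.
Proof.
move=> xO; have h : vball ord x 1 \in fset_set (residue_field K).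
  by apply/mem_residue_field; exists x.
exists (xget 0 (vball ord x 1)); first exact: map_f.
have [_ e] := residue_rep h; apply/vballE; rewrite -e.
by left.
Qed.

Lemma residue_reps_inj s s' : s \in rs -> s' \in rs -> s - s' \in mI 1 -> s = s'.
Proof.
move=> /mapP[X hX ->] /mapP[Y hY ->] h.
have [_ eX] := residue_rep hX; have [_ eY] := residue_rep hY.
by rewrite {1}eX {1}eY (vball_eq h) -eY.
Qed.

Lemma residue_reps_uniq : uniq rs.
Proof.
rewrite map_inj_in_uniq ?fset_uniq // => X Y hX hY e.
have [_ eX] := residue_rep hX; have [_ eY] := residue_rep hY.
by rewrite eX e -eY.
Qed.

Lemma residue_reps_size : size rs = q.
Proof. by rewrite size_map. Qed.

Lemma residue_card_gt1 : (1 < q)%N.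
Proof.
have [s sr hs] := residue_reps_ex (rpred0 _ : 0 \in Oi).
have [t tr ht] := residue_reps_ex (rpred1 _ : 1 \in Oi).
have st : s != t.
  apply/eqP => e; have : 1 \in mI 1.
    by rewrite -[1](subrK t) rpredD // -e -[s]opprK rpredN -[- s]add0r.
  by apply/negP; rewrite uO_ndiv // rpred1.
rewrite -residue_reps_size; apply: (@uniq_leq_size _ [:: s; t] rs); first by rewrite /= inE st.
by move=> x; rewrite !inE => /orP[] /eqP ->.
Qed.

(** Truncated [pi]-adic expansions, a complete residue system modulo [pi ^+ n]. *)
Fixpoint digits n : seq K :=
  if n is n'.+1 then [seq s + pi * a | s <- rs, a <- digits n'] else [:: 0].

Lemma digits_Oi n a : a \in digits n -> a \in Oi.
Proof.
elim: n a => [|n IHn] a; first by rewrite inE => /eqP ->; rewrite rpred0.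
move=> /allpairsP[[s b] /= [sr bD ->]].
by rewrite rpredD ?rpredM ?piO ?(residue_reps_Oi sr) ?(IHn _ bD).
Qed.

Lemma digits_ex n x : x \in Oi -> exists2 a, a \in digits n & x - a \in mI n.
Proof.
elim: n x => [|n IHn] x xO; first by exists 0; rewrite ?mem_head // subr0 mI0.
have [s sr /mIP[y yO yE]] := residue_reps_ex xO.
have [a aD ya] := IHn y yO; exists (s + pi * a).
  by apply/allpairsP; exists (s, a).
by rewrite opprD addrA yE expr1 -mulrBr mI_piS.
Qed.

Lemma digits_inj n a b :
  a \in digits n -> b \in digits n -> a - b \in mI n -> a = b.
Proof.
elim: n a b => [|n IHn] a b; first by rewrite !inE => /eqP -> /eqP ->.
move=> /allpairsP[[s a'] /= [sr aD ->]] /allpairsP[[t b'] /= [tr bD ->]].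
have aO := digits_Oi aD; have bO := digits_Oi bD.
rewrite opprD addrACA -mulrBr => h.
have st : s = t.
  apply: residue_reps_inj => //; have := mI_le (ltn0Sn n : 1 <= n.+1)%N h.
  by rewrite rpredDr // mI_piS mI0 rpredB.
by move: h; rewrite st subrr add0r mI_piS => /IHn ->.
Qed.

Lemma digits_size n : size (digits n) = (q ^ n)%N.
Proof. by elim: n => //= n IHn; rewrite size_allpairs IHn residue_reps_size expnS. Qed.

Lemma digits_uniq n : uniq (digits n).
Proof.
elim: n => // n IHn; apply: allpairs_uniq => //; first exact: residue_reps_uniq.
move=> [s a] [t b] /allpairsP[[s' a'] /= [sr aD [-> ->]]].
move=> /allpairsP[[t' b'] /= [tr bD [-> ->]]] e.
have aO := digits_Oi aD; have bO := digits_Oi bD.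
have st : s' = t'.
  apply: residue_reps_inj => //.
  have -> : s' - t' = pi * (b' - a').
    by rewrite mulrBr -[s'](addrK (pi * a')) e; ring.
  by rewrite mI_piS mI0 rpredB.
by move: e; rewrite st => /addrI/(mulfI pi0) ->.
Qed.

(** * Averages over residue systems *)

Section Averages.
Variable R : realType.
Local Notation C := R[i].

Section AverageTheory.
Implicit Types F G : K -> C.

Definition avg n F : C := (q%:R ^+ n)^-1 * \sum_(a <- digits n) F a.

Definition inv_mod n F :=
  forall x y, x \in Oi -> y \in Oi -> x - y \in mI n -> F x = F y.

Lemma qC_neq0 : q%:R != 0 :> C.
Proof. by rewrite pnatr_eq0 -lt0n (ltn_trans _ residue_card_gt1). Qed.

Lemma eq_avg n F G : (forall x, x \in Oi -> F x = G x) -> avg n F = avg n G.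
Proof.
move=> FG; rewrite /avg; congr (_ * _); apply: eq_big_seq => a aD.
by rewrite FG ?(digits_Oi aD).
Qed.

Lemma avgD n F G : avg n (fun x => F x + G x) = avg n F + avg n G.
Proof. by rewrite /avg big_split mulrDr. Qed.

Lemma avgZ n c F : avg n (fun x => c * F x) = c * avg n F.
Proof. by rewrite /avg -mulr_sumr mulrCA. Qed.

Lemma avgZr n c F : avg n (fun x => F x * c) = avg n F * c.
Proof. by rewrite /avg -mulr_suml mulrA. Qed.

Lemma avg_sum n (I : Type) (r : seq I) (P : pred I) (G : I -> K -> C) :
  avg n (fun x => \sum_(i <- r | P i) G i x) = \sum_(i <- r | P i) avg n (G i).
Proof. by rewrite /avg exchange_big -mulr_sumr. Qed.

Lemma avg_cst n c : avg n (fun=> c) = c.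
Proof.
rewrite /avg big_const_seq count_predT digits_size iter_addr_0 -natrX -[c *+ _]mulr_natl.
by rewrite mulKf // natrX expf_neq0 ?qC_neq0.
Qed.

Lemma avg_exchange m n (G : K -> K -> C) :
  avg m (fun x => avg n (G x)) = avg n (fun y => avg m (fun x => G x y)).
Proof.
rewrite /avg -!mulr_sumr [in LHS]mulrCA; congr (_ * (_ * _)).
exact: exchange_big.
Qed.

Lemma avgS n F :
  avg n.+1 F = q%:R^-1 * \sum_(s <- rs) avg n (fun a => F (s + pi * a)).
Proof.
by rewrite /avg /= big_allpairs_dep -mulr_sumr mulrA exprS invfM.
Qed.

Lemma avg_lift1 n F : inv_mod n F -> avg n.+1 F = avg n F.
Proof.
elim: n F => [|n IHn] F Fn; last first.
  rewrite [LHS]avgS [RHS]avgS; congr (_ * _); apply: eq_big_seq => s sr.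
  have sO := residue_reps_Oi sr.
  apply: IHn => x y xO yO xy; apply: Fn.
  - by rewrite rpredD ?rpredM ?piO.
  - by rewrite rpredD ?rpredM ?piO.
  by rewrite opprD addrACA subrr add0r -mulrBr mI_piS.
rewrite avgS (eq_big_seq (fun=> F 0)).
  rewrite big_const_seq count_predT residue_reps_size iter_addr_0 -[F 0 *+ _]mulr_natl.
  by rewrite mulKf ?qC_neq0 // /avg big_seq1 expr0 invr1 mul1r.
move=> s sr; rewrite -[RHS](avg_cst 0); apply: eq_avg => x xO.
have sO := residue_reps_Oi sr.
by apply: Fn; rewrite ?subr0 ?mI0 ?rpred0 //; rewrite rpredD ?rpredM ?piO.
Qed.

Lemma inv_mod_le m n F : (m <= n)%N -> inv_mod m F -> inv_mod n F.
Proof. by move=> mn Fm x y xO yO /(mI_le mn); apply: Fm. Qed.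

Lemma avg_lift m n F : (m <= n)%N -> inv_mod m F -> avg n F = avg m F.
Proof.
move=> + Fm; elim: n => [|n IHn]; first by rewrite leqn0 => /eqP ->.
rewrite leq_eqVlt => /orP[/eqP -> //|mn]; rewrite -IHn //.
by apply: avg_lift1; apply: inv_mod_le Fm.
Qed.

(** The change of variables formula. Reducing [h] to representatives maps the finite set [digits n]
    injectively into itself, hence permutes it. *)
Lemma avg_bij n F (h : K -> K) : inv_mod n F ->
  (forall x, x \in Oi -> h x \in Oi) ->
  (forall x y, x \in Oi -> y \in Oi -> h x - h y \in mI n -> x - y \in mI n) ->
  avg n (fun x => F (h x)) = avg n F.
Proof.
move=> Fn hO hI; rewrite /avg; congr (_ * _).
have [rep repP] : {rep : K -> K & forall x, x \in Oi ->
    rep x \in digits n /\ x - rep x \in mI n}.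
  apply: (@boolp.choice _ _ (fun x a => x \in Oi -> a \in digits n /\ x - a \in mI n)).
  move=> x; have [xO|_] := boolP (x \in Oi); last by exists 0.
  by have [a] := digits_ex n xO; exists a.
have -> : \sum_(a <- digits n) F (h a) = \sum_(a <- map (rep \o h) (digits n)) F a.
  rewrite big_map; apply: eq_big_seq => a /digits_Oi aO /=.
  have [rD hr] := repP _ (hO _ aO).
  by apply: Fn hr; rewrite ?hO ?(digits_Oi rD).
apply: perm_big; have mu : uniq [seq (rep \o h) i | i <- digits n].
  rewrite map_inj_in_uniq ?digits_uniq // => a b aD bD /= e.
  have aO := digits_Oi aD; have bO := digits_Oi bD.
  apply: (digits_inj aD bD); apply: hI => //.
  have [_ ha] := repP _ (hO _ aO); have [_ hb] := repP _ (hO _ bO).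
  rewrite e in ha; rewrite -[h a](subrK (rep (h b))) -addrA rpredD //.
  by rewrite -opprB rpredN.
apply: uniq_perm; rewrite ?digits_uniq //.
have sub : {subset [seq (rep \o h) i | i <- digits n] <= digits n}.
  by move=> _ /mapP[a /digits_Oi aO ->] /=; have [] := repP _ (hO _ aO).
by have [] := uniq_min_size mu sub; rewrite ?size_map.
Qed.

Lemma avg_shift n F c : c \in Oi -> inv_mod n F ->
  avg n (fun x => F (x + c)) = avg n F.
Proof.
move=> cO Fn; apply: (@avg_bij n F (fun x => x + c)) => // x; first by move=> xO; rewrite rpredD.
by move=> y xO yO; rewrite opprD addrACA subrr addr0.
Qed.

Lemma avg_unit n F u : u \in uO -> inv_mod n F ->
  avg n (fun x => F (u * x)) = avg n F.
Proof.
move=> uu Fn; apply: (@avg_bij n F (fun x => u * x)) => // x.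
  by move=> xO; rewrite rpredM // uO_Oi.
by move=> y xO yO; rewrite -mulrBr mI_uM.
Qed.

Lemma residue_reps_nonunit : exists2 s0, s0 \in rs &
  forall s, s \in rs -> (s \in uO) = (s != s0).
Proof.
have [s0 s0r] := residue_reps_ex (rpred0 _ : 0 \in Oi).
rewrite sub0r rpredN => s01; exists s0 => // s sr.
rewrite uO_notin_mI ?residue_reps_Oi //; congr (~~ _).
apply/idP/eqP => [s1|-> //]; apply: residue_reps_inj => //.
by rewrite rpredB.
Qed.

Lemma avg_split n F : inv_mod n.+1 F -> avg n.+1 F =
  q%:R^-1 * (\sum_(s <- rs | s \in uO) avg n (fun a => F (s + pi * a))
             + avg n (fun a => F (pi * a))).
Proof.
move=> Fn; rewrite avgS; congr (_ * _).
have [s0 s0r s0P] := residue_reps_nonunit.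
rewrite (bigID (fun s => s \in uO)) /=; congr (_ + _).
rewrite -big_filter.
have -> : [seq s <- rs | s \notin uO] = [:: s0].
  have := filter_pred1_uniq residue_reps_uniq s0r => <-.
  by apply: eq_in_filter => s sr; rewrite s0P //= negbK.
rewrite big_seq1; have s0O := residue_reps_Oi s0r.
have : s0 \in mI 1 by rewrite -[_ \in _]negbK -uO_notin_mI // s0P // eqxx.
move=> /mIP[e eO s0E].
(* The chosen representative [s0] of the zero class need not be 0; it is [pi * e], and a translation
   by [e] removes it. *)
rewrite -[RHS](@avg_shift n _ e) //.
  by apply: eq_avg => x xO; rewrite s0E expr1 mulrDr addrC.
move=> x y xO yO xy; apply: Fn; rewrite ?rpredM ?piO //.
by rewrite -mulrBr mI_piS.
Qed.

Lemma avg_norm n F (B : C) : (forall x, x \in Oi -> `|F x| <= B) -> `|avg n F| <= B.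
Proof.
move=> FB; rewrite /avg normrM normfV normrX normr_nat.
rewrite mulrC ler_pdivrMr ?exprn_gt0 ?lt0r ?qC_neq0 ?ler0n //.
apply: (le_trans (ler_norm_sum _ _ _)).
apply: (@le_trans _ _ (\sum_(a <- digits n) B)).
  by rewrite big_seq [leRHS]big_seq; apply: ler_sum => a /digits_Oi/FB.
rewrite big_const_seq count_predT digits_size iter_addr_0 -natrX.
by rewrite mulr_natr.
Qed.
End AverageTheory.

(** * Characters *)

Section LocallyConstantCharacter.
Variables (chi : K -> C) (chi_char : mult_char chi).

Lemma chi_M u v : u \in uO -> v \in uO -> chi (u * v) = chi u * chi v.
Proof. by move=> /unitsE hu /unitsE hv; case: chi_char => _ /(_ u v hu hv). Qed.

Lemma chi_neq0 u : u \in uO -> chi u != 0.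
Proof. by move=> /unitsE hu; case: chi_char => /(_ u hu). Qed.

Lemma chi_1 : chi 1 = 1.
Proof.
have h1 : 1 \in uO by rewrite rpred1.
by apply: (mulfI (chi_neq0 h1)); rewrite -chi_M // !mulr1.
Qed.

Lemma chi_X u n : u \in uO -> chi (u ^+ n) = chi u ^+ n.
Proof.
move=> uu; elim: n => [|n IHn]; first by rewrite !expr0 chi_1.
by rewrite !exprS chi_M ?rpredX // IHn.
Qed.

(* No small subgroups: as long as the powers of z stay close to 1, squaring
   multiplies the distance to 1 by at least 3/2. *)
Lemma eq1_small_powers (z : C) :
  (forall n, `|z ^+ n - 1| < 2^-1) -> z = 1.
Proof.
move=> zn; apply/eqP; rewrite -subr_eq0 -normr_le0.
have step n : (3 / 2) ^+ n * `|z - 1| <= `|z ^+ (2 ^ n) - 1|.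
  elim: n => [|n IHn]; first by rewrite expr0 mul1r expr1.
  rewrite exprS -mulrA expnSr exprM; set w := z ^+ (2 ^ n) in IHn *.
  have -> : w ^+ 2 - 1 = (w + 1) * (w - 1) by ring.
  rewrite normrM ler_pM ?mulr_ge0 ?exprn_ge0 ?invr_ge0 ?ler0n //.
  have -> : w + 1 = 2 - (1 - w) by ring.
  apply: le_trans (lerB_dist _ _); rewrite normr_nat distrC.
  rewrite lerBrDr -lerBrDl (le_trans (ltW (zn (2 ^ n)%N))) //.
  have -> : 2 - 3 / 2 = 2^-1 :> C by field.
  by [].
have {}step n : (3 / 2) ^+ n * `|z - 1| <= 1.
  apply: le_trans (step n) (le_trans (ltW (zn _)) _).
  by rewrite invf_le1 // ler1n.
have grow n : 1 + n%:R / 2 <= (3 / 2 : C) ^+ n.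
  elim: n => [|n IHn]; first by rewrite mul0r addr0 expr0.
  rewrite exprS; apply: (@le_trans _ _ (3 / 2 * (1 + n%:R / 2))).
    rewrite -subr_ge0.
    have -> : 3 / 2 * (1 + n%:R / 2) - (1 + n.+1%:R / 2) = n%:R / 4 :> C.
      by rewrite -natr1; field.
    by rewrite divr_ge0 ?ler0n.
  by rewrite ler_wpM2l // divr_ge0 ?ler0n.
set e := `|z - 1| in step *.
have e0 : 0 <= e by rewrite normr_ge0.
have {step}bnd n : n%:R * e <= 2.
  have := le_trans (ler_wpM2r e0 (grow n)) (step n).
  rewrite mulrDl mul1r => h.
  have : n%:R / 2 * e <= 1 by apply: le_trans h; rewrite lerDr.
  by rewrite mulrAC ler_pdivrMr ?ltr0n // mul1r.
have eR : e = (complex.Re e)%:C%C by rewrite RRe_real // ger0_real.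
rewrite eR lecR; rewrite leNgt; apply/negP => re0.
have := archi_boundP (divr_ge0 (ler0n R 2) (ltW re0)).
set n := Num.bound _; rewrite ltr_pdivrMr // => hn.
move: (bnd n); rewrite eR.
have -> : n%:R * (complex.Re e)%:C%C = (n%:R * complex.Re e)%:C%C :> C.
  by rewrite rmorphM rmorph_nat.
have -> : (2 : C) = (2 : R)%:C%C by rewrite rmorph_nat.
by rewrite lecR leNgt hn.
Qed.

(** Continuity at 1 puts [chi] of a small neighbourhood [1 + pi^M O] close to 1. This neighbourhood
    is stable under powers, so all powers of [chi u] stay close to 1, which forces [chi u = 1]. *)
Lemma chi_locally_trivial :
  exists2 M, (0 < M)%N & forall u, u - 1 \in mI M -> chi u = 1.
Proof.
have [_ _ /subspace_continuousP/(_ 1)] := chi_char.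
have u1 : units K 1 by apply/unitsE; rewrite rpred1.
move=> /(_ u1)/cvgrPdist_lt/(_ 2^-1); rewrite invr_gt0 ltr0n => /(_ isT).
rewrite /within /= => /nbhs_ordE[N NP].
(* The added 1 keeps the level positive, so that [u] is a unit for every [N]. *)
exists (`|N|%N).+1 => // u hu.
have hX n : u ^+ n - 1 \in mI (`|N|%N).+1.
  have uO : u \in Oi by rewrite -[u](subrK 1) rpredD ?rpred1 ?(mI_Oi hu).
  have [e eO] := exp_diff n uO (rpred1 _); rewrite expr1n => ->.
  exact: mIMr.
have uu n : u ^+ n \in uO.
  rewrite (@uO_congr _ 1) ?rpred1 //; exact: mI_le (hX n).
apply: eq1_small_powers => n.
rewrite -chi_X; last by rewrite -[u]expr1.
have /NP : vball ord 1 N (u ^+ n).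
  have [->|un] := eqVneq (u ^+ n) 1; first by left.
  right; have := hX n; rewrite mI_ord ?subr_eq0 //; apply: le_trans; lia.
by rewrite /from_subspace chi_1 distrC; apply; apply/unitsE.
Qed.

(** On units [chi] depends only on the class modulo [pi ^+ M], hence takes finitely many values.
    Digits that are not units merely enlarge the bound. *)
Lemma chi_bounded : exists B : C, forall u, u \in uO -> `|chi u| <= B.
Proof.
have [M M0 chiM] := chi_locally_trivial.
exists (\sum_(a <- digits M) `|chi a|) => u uu.
have [a aD ua] := digits_ex M (uO_Oi uu).
have au : a \in uO by rewrite -(uO_congr (mI_le M0 ua)).
have -> : u = a * (u / a) by rewrite mulrC divfK // uO_neq0.
rewrite chi_M ?rpred_div // (chiM (u / a)).
  rewrite mulr1 (bigD1_seq a) ?digits_uniq //= lerDl sumr_ge0 //.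
rewrite -[X in _ - X](divff (uO_neq0 au)) -mulrBl mIMr //.
by rewrite uO_Oi // rpredV.
Qed.
End LocallyConstantCharacter.

(** * The character on a level set of the valuation *)

Section LevelSets.
Variables (chi : K -> C) (chi_char : mult_char chi).
Variables (M : nat) (M_gt0 : (0 < M)%N).
Variable chiM : forall u, u - 1 \in mI M -> chi u = 1.
Variables (B : C) (chiB : forall u, u \in uO -> `|chi u| <= B).

(* The restriction of chi(ac v) to {ord v = m}. *)
Definition phi (m : nat) (v : K) : C :=
  if (v != 0) && (ord v == m) then chi (v / pi ^+ m) else 0.

Lemma phi_cond (m : nat) (v : K) : ((v != 0) && (ord v == m)) = (v / pi ^+ m \in uO).
Proof.
rewrite !inE mulf_eq0 invr_eq0 (negPf (pX0 m)) orbF.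
have [//|v0 /=] := eqVneq v 0.
by rewrite ordM ?invr_neq0 // ordV // ordX // ordpi natz subr_eq0.
Qed.

Lemma phi_congr m x y : x - y \in mI (m + M) -> phi m x = phi m y.
Proof.
move=> xy; rewrite /phi !phi_cond.
have h : x / pi ^+ m - y / pi ^+ m \in mI M.
  by rewrite -mulrBl -(mI_pi m) mulrC divfK.
rewrite (uO_congr (mI_le M_gt0 h)); case: ifP => // yu.
have xu : x / pi ^+ m \in uO by rewrite (uO_congr (mI_le M_gt0 h)).
set a := x / _ in h xu *; set b := y / _ in h yu *.
have -> : a = b * (a / b) by rewrite mulrC divfK // uO_neq0.
rewrite (chi_M chi_char yu (rpred_div xu yu)) [chi (a / b)]chiM ?mulr1 //.
rewrite -[X in _ - X](divff (uO_neq0 yu)) -mulrBl mIMr //.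
by rewrite uO_Oi // rpredV.
Qed.

Lemma phi_pi m e v : phi (e + m) (pi ^+ e * v) = phi m v.
Proof.
rewrite /phi !phi_cond exprD invfM mulrACA divff // mul1r //.
Qed.

Lemma phi_eq0 m v : v / pi ^+ m \notin uO -> phi m v = 0.
Proof. by rewrite /phi phi_cond => /negPf ->. Qed.

Lemma phi_lt m e v : (m < e)%N -> v \in mI e -> phi m v = 0.
Proof.
move=> me /mIP[w wO ->]; apply: phi_eq0.
have -> : pi ^+ e * w / pi ^+ m = pi ^+ (e - m) * w.
  by rewrite -(subnK (ltnW me)) exprD addnK; field.
have h : pi ^+ (e - m) * w \in mI 1.
  by rewrite (@mI_le 1 (e - m)) ?subn_gt0 // mIX.
by rewrite uO_notin_mI ?h ?(mI_Oi h).
Qed.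

Lemma phi_gt m e u : u \in uO -> (e < m)%N -> phi m (pi ^+ e * u) = 0.
Proof.
move=> uu em; rewrite /phi; case: ifP => // /andP[_].
rewrite ordM ?(uO_neq0 uu) // ordX // ordpi (uO_ord uu) addr0 natz => /eqP[e1].
by rewrite e1 ltnn in em.
Qed.

Lemma phi_unit m u v : u \in uO -> phi m (u * v) = chi u * phi m v.
Proof.
move=> uu; rewrite /phi !phi_cond -mulrA.
have [vu|vu] := boolP (v / pi ^+ m \in uO).
  by rewrite (rpredM uu vu) (chi_M chi_char uu vu).
by rewrite rpredMl ?unitfE ?(uO_neq0 uu) // (negPf vu) mulr0.
Qed.

Lemma phi_norm m v : `|phi m v| <= B.
Proof.
rewrite /phi phi_cond; case: ifP => [/chiB //|_]; rewrite normr0.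
by apply: le_trans (chiB (rpred1 _)).
Qed.

(** * Coefficients as averages *)

(** Integrality is part of the relation, so that preservation at level 0 already says that a map
    sends integers to integers. *)
Definition eqm n x y := [&& x \in Oi, y \in Oi & x - y \in mI n].

Lemma eqm_refl n x : x \in Oi -> eqm n x x.
Proof. by move=> xO; rewrite /eqm xO subrr rpred0. Qed.

Lemma eqm_Oil n x y : eqm n x y -> x \in Oi. Proof. by case/and3P. Qed.

Lemma eqm_mI n x y : eqm n x y -> x - y \in mI n. Proof. by case/and3P. Qed.

Lemma eqmD n x x' y y' : eqm n x x' -> eqm n y y' -> eqm n (x + y) (x' + y').
Proof.
move=> /and3P[xO x'O xx] /and3P[yO y'O yy]; apply/and3P; split; [exact: rpredD | exact: rpredD |].
by rewrite opprD addrACA rpredD.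
Qed.

Lemma eqmN n x x' : eqm n x x' -> eqm n (- x) (- x').
Proof.
move=> /and3P[xO x'O xx]; apply/and3P; split; rewrite ?rpredN //.
by rewrite -opprD rpredN.
Qed.

Lemma eqmM n x x' y y' : eqm n x x' -> eqm n y y' -> eqm n (x * y) (x' * y').
Proof.
move=> /and3P[xO x'O xx] /and3P[yO y'O yy]; apply/and3P; split; rewrite ?rpredM //.
have -> : x * y - x' * y' = (x - x') * y + x' * (y - y') by ring.
by rewrite rpredD //; [apply: mIMr | apply: mIMl].
Qed.

Lemma eqmX n x x' a : eqm n x x' -> eqm n (x ^+ a) (x' ^+ a).
Proof.
move=> h; elim: a => [|a IHa]; first by rewrite !expr0 eqm_refl ?rpred1.
by rewrite !exprS eqmM.
Qed.

Lemma eqm_horner n (F : {poly K}) x x' : F \is a polyOver Oi ->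
  eqm n x x' -> eqm n F.[x] F.[x'].
Proof.
move=> FO /and3P[xO x'O xx]; apply/and3P; split; rewrite ?horner_Oi //.
exact: horner_mI.
Qed.

(* Maps that preserve integrality and congruences, such as integral polynomials. *)
Definition cp1 (F : K -> K) := forall n x x', eqm n x x' -> eqm n (F x) (F x').
Definition cp2 (F : K -> K -> K) := forall n x x' y y',
  eqm n x x' -> eqm n y y' -> eqm n (F x y) (F x' y').
Definition cp3 (F : K -> K -> K -> K) := forall n x x' y y' z z',
  eqm n x x' -> eqm n y y' -> eqm n z z' -> eqm n (F x y z) (F x' y' z').

Lemma cp2_r F x : cp2 F -> x \in Oi -> cp1 (F x).
Proof. by move=> hF xO n y y' yy; apply: hF => //; apply: eqm_refl. Qed.

Lemma cp2_swap F : cp2 F -> cp2 (fun x y => F y x).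
Proof. by move=> hF n x x' y y' xx yy; apply: hF. Qed.

Lemma cp3_2 F z : cp3 F -> z \in Oi -> cp2 (fun x y => F x y z).
Proof. by move=> hF zO n x x' y y' xx yy; apply: hF => //; apply: eqm_refl. Qed.

(* The integrals of chi(ac F) over {ord F = m} in one, two and three variables:
   the level m + M suffices because phi m is invariant under pi^(m + M) O. *)
Definition A1 m (F : K -> K) : C := avg (m + M) (fun x => phi m (F x)).
Definition A2 m (F : K -> K -> K) : C := avg (m + M) (fun x => A1 m (F x)).
Definition A3 m (F : K -> K -> K -> K) : C :=
  avg (m + M) (fun z => A2 m (fun x y => F x y z)).

Lemma phi_inv m F : cp1 F -> inv_mod (m + M) (fun x => phi m (F x)).
Proof.
move=> hF x y xO yO xy; apply: phi_congr; apply: eqm_mI; apply: hF.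
by rewrite /eqm xO yO.
Qed.

Lemma A1_congr m F G : (forall x, x \in Oi -> F x - G x \in mI (m + M)) ->
  A1 m F = A1 m G.
Proof. by move=> FG; apply: eq_avg => x xO; apply: phi_congr; apply: FG. Qed.

Lemma eq_A1 m F G : (forall x, x \in Oi -> F x = G x) -> A1 m F = A1 m G.
Proof. by move=> FG; apply: eq_avg => x xO; rewrite FG. Qed.

Lemma eq_A2 m F G : (forall x y, x \in Oi -> y \in Oi -> F x y = G x y) ->
  A2 m F = A2 m G.
Proof. by move=> FG; apply: eq_avg => x xO; apply: eq_A1 => y; apply: FG. Qed.

Lemma eq_A3 m F G :
  (forall x y z, x \in Oi -> y \in Oi -> z \in Oi -> F x y z = G x y z) ->
  A3 m F = A3 m G.
Proof. by move=> FG; apply: eq_avg => z zO; apply: eq_A2 => x y xO yO; apply: FG. Qed.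

Lemma A1_lift m n F : cp1 F -> (m + M <= n)%N ->
  avg n (fun x => phi m (F x)) = A1 m F.
Proof. by move=> hF mn; apply: avg_lift => //; apply: phi_inv. Qed.

Lemma A1_inv m F : cp2 F -> inv_mod (m + M) (fun x => A1 m (F x)).
Proof.
move=> hF x x' xO x'O xx; apply: A1_congr => y yO; apply: eqm_mI.
by apply: hF; [rewrite /eqm xO x'O | apply: eqm_refl].
Qed.

Lemma A2_inv m F : cp3 F -> inv_mod (m + M) (fun z => A2 m (fun x y => F x y z)).
Proof.
move=> hF z z' zO z'O zz; apply: eq_avg => x xO.
apply: (A1_inv (F := fun z y => F x y z)) => //.
by move=> n a a' b b' aa bb; apply: hF => //; apply: eqm_refl.
Qed.

Lemma A2_swap m F : A2 m F = A2 m (fun x y => F y x).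
Proof. by rewrite /A2 /A1 avg_exchange. Qed.

Lemma A3_swap m F : A3 m F = A3 m (fun x y z => F x z y).
Proof.
rewrite /A3 /A2 /A1.
under eq_avg => z _ do rewrite avg_exchange.
rewrite avg_exchange.
by under [RHS]eq_avg => z _ do rewrite avg_exchange.
Qed.

Lemma A1_norm m F : `|A1 m F| <= B.
Proof. by apply: avg_norm => x _; apply: phi_norm. Qed.

Lemma A2_norm m F : `|A2 m F| <= B.
Proof. by apply: avg_norm => x _; apply: A1_norm. Qed.

Lemma A3_norm m F : `|A3 m F| <= B.
Proof. by apply: avg_norm => x _; apply: A2_norm. Qed.

Lemma A1_split m F : cp1 F -> A1 m F =
  q%:R^-1 * (\sum_(s <- rs | s \in uO) A1 m (fun x => F (s + pi * x))
             + A1 m (fun x => F (pi * x))).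
Proof.
move=> hF; rewrite -(A1_lift hF (leqnSn _)) avg_split //.
by apply: inv_mod_le (phi_inv hF).
Qed.

Lemma A2_split_x m F : cp2 F -> A2 m F =
  q%:R^-1 * (\sum_(s <- rs | s \in uO) A2 m (fun x y => F (s + pi * x) y)
             + A2 m (fun x y => F (pi * x) y)).
Proof.
move=> hF; have h := A1_inv (m := m) hF.
rewrite {1}/A2 -(avg_lift (leqnSn _) h) avg_split //.
exact: inv_mod_le h.
Qed.

Lemma A2_split_y m F : cp2 F -> A2 m F =
  q%:R^-1 * (\sum_(s <- rs | s \in uO) A2 m (fun x y => F x (s + pi * y))
             + A2 m (fun x y => F x (pi * y))).
Proof.
move=> /cp2_swap hF; rewrite A2_swap (A2_split_x m hF).
congr (_ * (_ + _)); last by rewrite A2_swap.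
by apply: eq_bigr => s _; rewrite A2_swap.
Qed.

Lemma A3_split_z m F : cp3 F -> A3 m F =
  q%:R^-1 * (\sum_(s <- rs | s \in uO) A3 m (fun x y z => F x y (s + pi * z))
             + A3 m (fun x y z => F x y (pi * z))).
Proof.
move=> hF; have h := A2_inv (m := m) hF.
rewrite {1}/A3 -(avg_lift (leqnSn _) h) avg_split //.
exact: inv_mod_le h.
Qed.

Lemma A3_split_y m F : cp3 F -> A3 m F =
  q%:R^-1 * (\sum_(s <- rs | s \in uO) A3 m (fun x y z => F x (s + pi * y) z)
             + A3 m (fun x y z => F x (pi * y) z)).
Proof.
move=> hF; rewrite A3_swap A3_split_z; last first.
  by move=> n x x' y y' z z' xx yy zz; apply: hF.
congr (_ * (_ + _)); last by rewrite A3_swap.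
by apply: eq_bigr => s _; rewrite A3_swap.
Qed.

Lemma A3_split_x m F : cp3 F -> A3 m F =
  q%:R^-1 * (\sum_(s <- rs | s \in uO) A3 m (fun x y z => F (s + pi * x) y z)
             + A3 m (fun x y z => F (pi * x) y z)).
Proof.
move=> hF; rewrite /A3 -avg_sum -avgD -avgZ; apply: eq_avg => z zO.
by rewrite A2_split_x //; apply: cp3_2.
Qed.

Lemma A1_unit m u F : u \in uO -> A1 m (fun x => u * F x) = chi u * A1 m F.
Proof. by move=> uu; rewrite /A1 -avgZ; apply: eq_avg => x _; rewrite phi_unit. Qed.

Lemma A2_unit m u F : u \in uO -> A2 m (fun x y => u * F x y) = chi u * A2 m F.
Proof. by move=> uu; rewrite /A2 -avgZ; apply: eq_avg => x _; rewrite A1_unit. Qed.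

Lemma A3_unit m u F : u \in uO -> A3 m (fun x y z => u * F x y z) = chi u * A3 m F.
Proof. by move=> uu; rewrite /A3 -avgZ; apply: eq_avg => x _; rewrite A2_unit. Qed.

Lemma A1_scale m u F : cp1 F -> u \in uO -> A1 m (fun x => F (u * x)) = A1 m F.
Proof.
by move=> hF uu; apply: (avg_unit (F := fun x => phi m (F x))) => //; apply: phi_inv.
Qed.

Lemma A2_scale_x m u F : cp2 F -> u \in uO ->
  A2 m (fun x y => F (u * x) y) = A2 m F.
Proof.
by move=> hF uu; apply: (avg_unit (F := fun x => A1 m (F x))) => //; apply: A1_inv.
Qed.

Lemma A2_scale_y m u F : cp2 F -> u \in uO ->
  A2 m (fun x y => F x (u * y)) = A2 m F.
Proof.
by move=> hF uu; rewrite A2_swap (A2_scale_x m (cp2_swap hF)) // -A2_swap.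
Qed.

Lemma A2_shift_x m c F : cp2 F -> c \in Oi ->
  A2 m (fun x y => F (x + c) y) = A2 m F.
Proof.
by move=> hF cO; apply: (avg_shift (F := fun x => A1 m (F x))) => //; apply: A1_inv.
Qed.

Lemma A2_shift_y m c F : cp2 F -> c \in Oi ->
  A2 m (fun x y => F x (y + c)) = A2 m F.
Proof.
by move=> hF cO; rewrite A2_swap (A2_shift_x m (cp2_swap hF)) // -A2_swap.
Qed.

Lemma A1_pi m e F : cp1 F -> A1 m (fun x => pi ^+ e * F x) =
  if (e <= m)%N then A1 (m - e) F else 0.
Proof.
move=> hF; case: leqP => em; last first.
  rewrite -[RHS](avg_cst (m + M)); apply: eq_avg => x xO.
  rewrite (phi_lt (e := e)) // mIX.
  exact: eqm_Oil (hF 0%N _ _ (eqm_refl 0 xO)).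
rewrite -(@A1_lift (m - e) (m + M)) //; last by rewrite leq_add2r leq_subr.
by apply: eq_avg => x xO; rewrite -{1}(subnKC em) phi_pi.
Qed.

Lemma A2_pi m e F : cp2 F -> A2 m (fun x y => pi ^+ e * F x y) =
  if (e <= m)%N then A2 (m - e) F else 0.
Proof.
move=> hF; rewrite /A2.
under eq_avg => x xO do rewrite (A1_pi _ _ (cp2_r hF xO)).
case: leqP => em; last by rewrite avg_cst.
apply: avg_lift; last exact: A1_inv.
by rewrite leq_add2r leq_subr.
Qed.

Lemma A3_pi m e F : cp3 F -> A3 m (fun x y z => pi ^+ e * F x y z) =
  if (e <= m)%N then A3 (m - e) F else 0.
Proof.
move=> hF; rewrite /A3.
under eq_avg => x xO do rewrite (A2_pi _ _ (cp3_2 hF xO)).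
case: leqP => em; last by rewrite avg_cst.
apply: avg_lift; last exact: A2_inv.
by rewrite leq_add2r leq_subr.
Qed.

Lemma A1_unit0 m e F : (forall x, x \in Oi -> F x \in uO) -> (e < m)%N ->
  A1 m (fun x => pi ^+ e * F x) = 0.
Proof.
move=> Fu em; rewrite -[RHS](avg_cst (m + M)); apply: eq_avg => x xO.
by rewrite phi_gt ?Fu.
Qed.

Lemma A2_unit0 m e F : (forall x y, x \in Oi -> y \in Oi -> F x y \in uO) ->
  (e < m)%N -> A2 m (fun x y => pi ^+ e * F x y) = 0.
Proof.
move=> Fu em; rewrite -[RHS](avg_cst (m + M)); apply: eq_avg => x xO.
by rewrite A1_unit0 // => y yO; apply: Fu.
Qed.

Lemma A3_unit0 m e F :
  (forall x y z, x \in Oi -> y \in Oi -> z \in Oi -> F x y z \in uO) ->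
  (e < m)%N -> A3 m (fun x y z => pi ^+ e * F x y z) = 0.
Proof.
move=> Fu em; rewrite -[RHS](avg_cst (m + M)); apply: eq_avg => x xO.
by rewrite A2_unit0 // => y z yO zO; apply: Fu.
Qed.

Lemma cp1_id : cp1 id. Proof. by []. Qed.

Lemma cp1_pi : cp1 (fun x => pi * x).
Proof. by move=> n x x' xx; apply: eqmM => //; apply: eqm_refl; apply: piO. Qed.

Lemma A1_idE m : A1 m id = (q%:R ^+ m)^-1 * A1 0 id.
Proof.
elim: m => [|m IHm]; first by rewrite expr0 invr1 mul1r.
rewrite A1_split; last exact: cp1_id.
rewrite big1_seq ?add0r => [|s /andP[su _]].
  have := A1_pi m.+1 1 cp1_id; rewrite subn1 /= expr1 => ->.
  by rewrite IHm exprS invfM mulrA.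
have := @A1_unit0 m.+1 0 (fun x => s + pi * x).
rewrite expr0 => h; rewrite -[RHS]h //.
  by apply: eq_A1 => x _; rewrite mul1r.
move=> x xO; apply: uO_addl => //; by rewrite mI_piS mI0.
Qed.

(* x V(x) - y V(y) = (x - y) (V(x) + pi y e) modulo pi^n, and the second factor is a
   unit. *)
Lemma avg_bij_mul n F (V : K -> K) : inv_mod n F ->
  (forall x, x \in Oi -> V x \in uO) ->
  (forall x y, x \in Oi -> y \in Oi ->
     exists2 e, e \in Oi & V x - V y - pi * (x - y) * e \in mI n) ->
  avg n (fun x => F (x * V x)) = avg n F.
Proof.
move=> Fn Vu VV; apply: (avg_bij (h := fun x => x * V x)) => // [x xO|x y xO yO h].
  by rewrite rpredM // uO_Oi ?Vu.
have [e eO he] := VV x y xO yO.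
have u : V x + pi * (y * e) \in uO.
  by rewrite uO_addl ?Vu // mI_piS mI0 rpredM.
rewrite -(mI_uM _ _ u).
have -> : (V x + pi * (y * e)) * (x - y) =
  (x * V x - y * V y) - y * (V x - V y - pi * (x - y) * e) by ring.
by rewrite rpredB // mIMl.
Qed.

(** * Smooth and quasihomogeneous local integrals *)

Section LocalIntegrals.
Variable w : {poly K}.
Hypotheses (wO : w \is a polyOver Oi) (w0 : w.[0] \in uO).

Lemma w_unit Y : Y \in Oi -> w.[pi * Y] \in uO.
Proof.
move=> YO; rewrite (@uO_congr _ w.[0]) // horner_mI ?rpred0 //.
  by rewrite rpredM ?piO.
by rewrite subr0 mI_piS mI0.
Qed.

Lemma A1_smooth m e : e \in Oi ->
  A1 m (fun Y => e + pi * Y * w.[pi * Y]) = A1 m (fun Y => e + pi * Y).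
Proof.
move=> eO; transitivity (A1 m (fun Y => e + pi * (Y * w.[pi * Y]))).
  by apply: eq_A1 => x _; rewrite mulrA.
apply: (avg_bij_mul (F := fun x => phi m (e + pi * x))).
- by apply: phi_inv => n x x' xx; apply: eqmD (eqm_refl _ eO) _; apply: cp1_pi.
- by move=> x xO; apply: w_unit.
move=> x y xO yO.
have [pxO pyO] : pi * x \in Oi /\ pi * y \in Oi by rewrite !rpredM ?piO.
have [d dO dE] := horner_diff wO pxO pyO.
by exists d => //; rewrite dE -mulrBr subrr rpred0.
Qed.

Lemma A1_line m e : e \in Oi -> A1 m.+1 (fun Y => e + pi * Y) =
  (if e \in mI 1 then (q%:R ^+ m)^-1 * A1 0 id else 0).
Proof.
move=> eO; case: ifP => [/mIP[d dO ->]|/negbT e1].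
  rewrite -A1_idE.
  transitivity (A1 m.+1 (fun Y => pi ^+ 1 * (Y + d))).
    by apply: eq_A1 => x _; rewrite expr1 mulrDr addrC.
  rewrite A1_pi /= ?subn1 /=; last first.
    by move=> n x x' xx; apply: eqmD => //; apply: eqm_refl.
  by apply: (avg_shift (F := fun x => phi m x)) => //; apply: phi_inv cp1_id.
transitivity (A1 m.+1 (fun Y => pi ^+ 0 * (e + pi * Y))).
  by apply: eq_A1 => x _; rewrite mul1r.
apply: A1_unit0 => // x xO; apply: uO_addl; first by rewrite uO_notin_mI.
by rewrite mI_piS mI0.
Qed.

(** For fixed [x] the variable [Y] can be changed so that the polynomial becomes [E x + pi * Y]. A
    positive order then requires [E x] in [mI 1], and from there on the coefficients decay with
    ratio [1/q]. *)
Lemma smooth_gf (E : K -> K) : cp1 E ->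
  gfE (1 - q%:R^-1 *: 'X^1)
    (fun m => A2 m (fun x Y => E x + pi * Y * w.[pi * Y])).
Proof.
move=> hE; rewrite -[X in gfE X]mul1r; apply: (gfE_rec (B := B)).
  by move=> m; apply: A2_norm.
have EO x : x \in Oi -> E x \in Oi.
  by move=> xO; apply: eqm_Oil (hE 0%N _ _ (eqm_refl 0 xO)).
have val m : A2 m.+1 (fun x Y => E x + pi * Y * w.[pi * Y]) =
    avg 1 (fun x => (E x \in mI 1)%:R) * ((q%:R ^+ m)^-1 * A1 0 id).
  rewrite /A2 -(@avg_lift 1 (m.+1 + M)) //.
    rewrite -avgZr; apply: eq_avg => x xO.
    by rewrite A1_smooth ?A1_line ?EO //; case: ifP; rewrite ?mul1r ?mul0r.
  move=> x y xO yO xy; congr (_ %:R); congr nat_of_bool.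
  have /eqm_mI h : eqm 1 (E x) (E y) by apply: hE; apply/and3P.
  by apply/idP/idP => h'; [rewrite -[E y](subKr (E x)) rpredB |
    rewrite -[E x](subrK (E y)) rpredD].
(* The geometric law starts at coefficient 1, so the recursion holds from index 2 on. *)
apply: (@gfE_fin _ 2) => -[|[|m]] // _.
by rewrite subn1 /= !val exprS invfM; ring.
Qed.

Variables (p a : nat) (a_unit : (a%:R : K) \in uO).

(** The unit [w.[pi * Y] / w.[0]] is congruent to 1, so it has an approximate [a]-th root [V Y]. The
    substitution of [Y * V Y] for [Y] preserves the average and turns [w] into the constant
    [w.[0]]. *)
Lemma A1_singular m e : e \in Oi ->
  A1 m (fun Y => e + (pi * Y) ^+ a * w.[pi * Y]) =
  A1 m (fun Y => e + pi ^+ a * (w.[0] * Y ^+ a)).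
Proof.
move=> eO; have w00 := uO_neq0 w0.
have [V VP] : {V : K -> K & forall Y, Y \in Oi ->
    V Y - 1 \in mI 1 /\ V Y ^+ a - w.[pi * Y] / w.[0] \in mI (m + M).+1}.
  apply: (@boolp.choice _ _ (fun Y v => Y \in Oi -> v - 1 \in mI 1 /\
     v ^+ a - w.[pi * Y] / w.[0] \in mI (m + M).+1)) => Y.
  have [YO|_] := boolP (Y \in Oi); last by exists 0.
  have h : w.[pi * Y] / w.[0] - 1 \in mI 1.
    rewrite -[X in _ - X](divff w00) -mulrBl mIMr ?uO_Oi ?rpredV //.
    rewrite horner_mI ?rpred0 ?rpredM ?piO //.
    by rewrite subr0 mI_piS mI0.
  by have [v v1 va] := approx_root a_unit (m + M) h; exists v.
have VE Y : Y \in Oi -> V Y ^+ a - w.[pi * Y] / w.[0] \in mI (m + M).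
  by move=> /VP[_]; apply: mI_le.
transitivity (A1 m (fun Y => e + pi ^+ a * (w.[0] * (Y * V Y) ^+ a))).
  apply: A1_congr => Y YO.
  have -> : e + (pi * Y) ^+ a * w.[pi * Y] - (e + pi ^+ a * (w.[0] * (Y * V Y) ^+ a))
     = - (pi ^+ a * Y ^+ a * w.[0]) * (V Y ^+ a - w.[pi * Y] / w.[0]).
    by rewrite !exprMn; field.
  by rewrite mIMl ?VE // rpredN rpredM ?(uO_Oi w0) // rpredM ?rpredX ?piO.
apply: (avg_bij_mul (F := fun x => phi m (e + pi ^+ a * (w.[0] * x ^+ a)))).
- apply: phi_inv => n x x' xx; apply: eqmD (eqm_refl _ eO) _.
  apply: eqmM; first by rewrite eqm_refl ?rpredX ?piO.
  by apply: eqmM (eqm_refl _ (uO_Oi w0)) _; apply: eqmX.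
- by move=> Y YO; have [h _] := VP Y YO; rewrite (uO_congr h) rpred1.
move=> x y xO yO.
have [pxO pyO] : pi * x \in Oi /\ pi * y \in Oi by rewrite !rpredM ?piO.
have [d dO dE] := horner_diff wO pxO pyO.
have [Vx _] := VP x xO; have [Vy _] := VP y yO.
have [u u1 uE] := exp_diff1 a Vx Vy.
have uu : u \in uO by rewrite (uO_congr u1).
have u0 := uO_neq0 uu.
(* Up to the precision of the roots, [(V x - V y) * u] is the difference of the values of [w /
   w.[0]] at [pi * x] and [pi * y], which is [pi * (x - y) * d / w.[0]]. *)
exists (d / w.[0] / u).
  by rewrite -mulrA rpredM // uO_Oi // rpredM // rpredV.
have -> : V x - V y - pi * (x - y) * (d / w.[0] / u) =
    u^-1 * ((V x ^+ a - w.[pi * x] / w.[0]) - (V y ^+ a - w.[pi * y] / w.[0])).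
  have -> : V x ^+ a = V y ^+ a + (V x - V y) * u by rewrite -uE addrCA subrr addr0.
  have -> : w.[pi * x] = w.[pi * y] + (pi * x - pi * y) * d by rewrite -dE addrCA subrr addr0.
  by field; rewrite u0 w00.
by rewrite mIMl ?uO_Oi ?rpredV // rpredB ?VE.
Qed.
End LocalIntegrals.

Lemma horner_taylor (h : {poly K}) s : h \is a polyOver Oi -> s \in Oi ->
  exists w : {poly K}, [/\ w \is a polyOver Oi, w.[0] = h^`().[s]
    & forall Y, h.[s + Y] = h.[s] + Y * w.[Y]].
Proof.
move=> hO sO; elim/poly_ind: h hO => [|F c IHF] FO.
  by exists 0; split; rewrite ?rpred0 ?deriv0 ?horner0 // => Y; rewrite !horner0 mulr0 addr0.
have FO' : F \is a polyOver Oi.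
  apply/polyOverP => i; have /polyOverP/(_ i.+1) := FO.
  by rewrite coefD coefMX coefC /= addr0.
have [w [wO w0 wE]] := IHF FO'.
exists (F.[s]%:P + w * ('X + s%:P)); split.
- by rewrite rpredD ?rpredM ?rpredD ?polyOverC ?polyOverX ?horner_Oi.
- by rewrite derivD derivM derivX derivC !hornerE w0; ring.
- by move=> Y; rewrite !hornerE wE; ring.
Qed.

(** * The quasihomogeneous polynomial x^p + c y^a *)

Section Quasihomogeneous.
Variables (p a : nat) (c : K).
Hypotheses (p_gt0 : (0 < p)%N) (a_gt0 : (0 < a)%N) (co_pa : coprime p a).
Hypotheses (a_unit : (a%:R : K) \in uO) (c_unit : c \in uO).

Let Qsm : {poly C} := 1 - q%:R^-1 *: 'X^1.
Let E m := A2 m (fun x y => x ^+ p + c * y ^+ a).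
Let H i j m := A2 m (fun x y => pi ^+ i * x ^+ p + pi ^+ j * (c * y ^+ a)).

Let cp_xy i j : cp2 (fun x y => pi ^+ i * x ^+ p + pi ^+ j * (c * y ^+ a)).
Proof.
move=> n x x' y y' xx yy; have cO := uO_Oi c_unit.
apply: eqmD; apply: eqmM; rewrite ?eqm_refl ?rpredX ?piO ?eqmX //.
by apply: eqmM; rewrite ?eqm_refl ?eqmX.
Qed.

Let uO_sX s x : s \in uO -> x \in Oi -> s + pi * x \in uO.
Proof. by move=> su xO; apply: uO_addl; rewrite ?mI_piS ?mI0. Qed.

(** If [x] is a unit, the first monomial dominates and the order is exactly [i], below [m]. Only [x]
    divisible by [pi] contributes. *)
Let split_x i j m : (i < j)%N -> (i < m)%N -> H i j m = q%:R^-1 * H (i + p) j m.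
Proof.
move=> ij im; rewrite /H A2_split_x; last exact: cp_xy.
rewrite big1_seq ?add0r => [|s /andP[su _]].
  congr (_ * _); apply: eq_A2 => x y _ _.
  by rewrite exprD exprMn; ring.
rewrite -[RHS](@A2_unit0 m i
  (fun x y => (s + pi * x) ^+ p + pi ^+ (j - i) * (c * y ^+ a))) //.
  by apply: eq_A2 => x y _ _; rewrite -{1}(subnKC (ltnW ij)) exprD; ring.
move=> x y xO yO; apply: uO_addl; first by rewrite rpredX ?uO_sX.
rewrite (@mI_le 1 (j - i)) ?subn_gt0 // mIX rpredM ?rpredX //.
exact: uO_Oi.
Qed.

Let split_y i j m : (j < i)%N -> (j < m)%N -> H i j m = q%:R^-1 * H i (j + a) m.
Proof.
move=> ij im; rewrite /H A2_split_y; last exact: cp_xy.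
rewrite big1_seq ?add0r => [|s /andP[su _]].
  congr (_ * _); apply: eq_A2 => x y _ _.
  by rewrite exprD exprMn; ring.
rewrite -[RHS](@A2_unit0 m j
  (fun x y => c * (s + pi * y) ^+ a + pi ^+ (i - j) * x ^+ p)) //.
  by apply: eq_A2 => x y _ _; rewrite -{1}(subnKC (ltnW ij)) exprD; ring.
move=> x y xO yO; apply: uO_addl; first by rewrite rpredM ?rpredX ?uO_sX.
by rewrite (@mI_le 1 (i - j)) ?subn_gt0 // mIX rpredX.
Qed.

(* Divide out pi alternately from x and y, always in the monomial of smaller order;
   as p and a are coprime, the orders p i and a j first agree at p a. *)
Let H_iter n i j : (a - i + (p - j))%N = n -> (i <= a)%N -> (j <= p)%N ->
  (0 < i + j)%N -> exists m0, forall m, (m0 <= m)%N ->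
  H (p * i) (a * j) m =
    (q%:R ^+ n)^-1 * (if (p * a <= m)%N then E (m - p * a) else 0).
Proof.
elim: n i j => [|n IHn] i j nE ia jp ij0.
  exists 0%N => m _; have -> : i = a by lia.
  have -> : j = p by lia.
  rewrite expr0 invr1 mul1r mulnC -A2_pi.
    by apply: eq_A2 => x y _ _; rewrite mulrDr.
  move=> k x x' y y' xx yy; apply: eqmD; rewrite ?eqmX //.
  by apply: eqmM; rewrite ?eqmX // eqm_refl // uO_Oi.
have [ij|ij|e] := ltngtP (p * i)%N (a * j)%N.
- have ia' : (i < a)%N.
    by rewrite -(ltn_pmul2l p_gt0) (leq_trans ij) // mulnC leq_mul2r jp orbT.
  have [||||m0 hm0] := IHn i.+1 j; [lia..|].
  exists (maxn m0 (p * i).+1) => m; rewrite geq_max => /andP[mm0 im].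
  by rewrite split_x // -mulnSr hm0 // exprS invfM mulrA.
- have jp' : (j < p)%N.
    rewrite -(ltn_pmul2l a_gt0) (leq_trans ij) //.
    by rewrite [(a * p)%N]mulnC leq_mul2l ia orbT.
  have [||||m0 hm0] := IHn i j.+1; [lia..|].
  exists (maxn m0 (a * j).+1) => m; rewrite geq_max => /andP[mm0 im].
  by rewrite split_y // -mulnSr hm0 // exprS invfM mulrA.
(* Equal orders [p i = a j] force [i = a] and [j = p] by coprimality, so that nothing would be left
   to divide out, against [nE]. *)
- have ai : (a %| i)%N.
    by rewrite -(@Gauss_dvdr _ p) ?e ?dvdn_mulr // coprime_sym.
  have i0 : (0 < i)%N.
    rewrite lt0n; apply/eqP => i0; move: e; rewrite i0 muln0 => /esym/eqP.
    by rewrite muln_eq0 => /orP[]/eqP; lia.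
  have ea : i = a by apply/eqP; rewrite eqn_leq ia dvdn_leq.
  have ep : j = p by apply/eqP; rewrite -(eqn_pmul2l a_gt0) -e ea mulnC.
  by move: nE; rewrite ea ep; lia.
Qed.

Let smooth_part m :=
  \sum_(s <- rs | s \in uO) A2 m (fun x y => x ^+ p + c * (s + pi * y) ^+ a).

Let smooth_part_gf : gfE Qsm smooth_part.
Proof.
apply: gfE_sum => s su; have sO := uO_Oi su.
have hO : c *: 'X^a \is a polyOver Oi.
  by rewrite polyOverZ ?rpredX ?polyOverX // uO_Oi.
have [w [wO w0 wE]] := horner_taylor hO sO.
have w0u : w.[0] \in uO.
  rewrite w0 derivZ derivXn hornerZ hornerMn hornerXn -mulr_natr.
  by rewrite !rpredM ?rpredX.
apply: gfE_ext (smooth_gf wO w0u (E := fun x => x ^+ p + c * s ^+ a) _).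
  move=> m; apply: eq_A2 => x y xO yO.
  have := wE (pi * y); rewrite !hornerZ !hornerXn => ->.
  by rewrite addrA.
move=> n x x' xx; apply: eqmD; rewrite ?eqmX // eqm_refl // rpredM ?rpredX //.
exact: uO_Oi.
Qed.

Let E_split m : E m = q%:R^-1 * (smooth_part m + H (p * 0) (a * 1) m).
Proof.
rewrite /E A2_split_y; last first.
  move=> n x x' y y' xx yy; apply: eqmD; rewrite ?eqmX //.
  by apply: eqmM; rewrite ?eqmX // eqm_refl // uO_Oi.
congr (_ * (_ + _)); apply: eq_A2 => x y _ _.
by rewrite muln0 muln1 mul1r exprMn; ring.
Qed.

Definition Qsing : {poly C} := Qsm * (1 - (q%:R ^+ (p + a))^-1 *: 'X^(p * a)).

Lemma quasihomogeneous_gf : gfE Qsing E.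
Proof.
apply: (gfE_rec (B := B)) => [m|]; first exact: A2_norm.
(* The splitting in [E_split] has already divided [y] by [pi] once, so [a + p - 1] of the [a + p]
   divisions remain. *)
have [||||m0 hm0] := H_iter (n := (a + p).-1) (i := 0) (j := 1); [lia..|].
apply: (@gfE_eventually _ _ _ (fun m => q%:R^-1 * smooth_part m) m0).
  move=> m mm0; rewrite {1}E_split hm0 //.
  have -> : (p + a)%N = (a + p).-1.+1 by lia.
  by rewrite mulrDr mulrA -invfM -exprS addrK.
exact: gfE_scale.
Qed.

Lemma singular_gf (w : {poly K}) : w \is a polyOver Oi -> w.[0] = c ->
  gfE Qsing (fun m => A2 m (fun x Y => x ^+ p + (pi * Y) ^+ a * w.[pi * Y])).
Proof.
move=> wO w0; apply: (gfE_ext (c := fun m => q%:R * E m + -1 * smooth_part m)).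
  move=> m; rewrite E_split mulrA divff ?qC_neq0 // mul1r addrC mulN1r addKr.
  apply: eq_avg => x xO; rewrite (A1_singular wO _ a_unit) ?w0 ?rpredX //.
  by apply: eq_A1 => y _; rewrite muln0 muln1 mul1r.
apply: gfE_add; apply: gfE_scale; first exact: quasihomogeneous_gf.
exact: gfE_mul.
Qed.
End Quasihomogeneous.

(** * The hybrid polynomial *)

Lemma eqm_sum n a b (F G : nat -> K) :
  (forall i, eqm n (F i) (G i)) ->
  eqm n (\sum_(a <= i < b) F i) (\sum_(a <= i < b) G i).
Proof.
move=> FG; elim/big_ind2: _ => //; last by move=> x x' y y'; apply: eqmD.
by rewrite eqm_refl ?rpred0.
Qed.

Lemma hybrid_cp3 p k r l t : t \in Oi -> cp3 (hybrid p k r l t).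
Proof.
move=> tO n x x' y y' z z' xx yy zz; apply: eqmD; first exact: eqmX.
apply: eqmM; first by apply: eqmM; apply: eqmX.
apply: eqm_sum => i; apply: eqmM; last first.
  by apply: eqmX; apply: eqmD; [apply: eqmM => //; apply: eqm_refl | apply: eqmN].
by apply: eqmM; [rewrite eqm_refl ?rpred_nat | apply: eqmX].
Qed.

(** Replacing [y] by [t y] multiplies each term of the second summand by [t^(k+r)]. This is the
    [p]-th power of [tau^(k+r)], so scaling [x] by that unit makes the whole polynomial a unit
    multiple of the one for [t = 1]. *)
Lemma A3_hybrid_t p k r l tau m : tau \in uO ->
  A3 m (hybrid p k r l (tau ^+ p)) =
  chi (tau ^+ p ^+ (k + r)) * A3 m (hybrid p k r l 1).
Proof.
move=> tu; have tpu : tau ^+ p \in uO by rewrite rpredX.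
rewrite -A3_unit ?rpredX //; apply: eq_avg => z zO.
rewrite -[LHS](@A2_scale_x _ (tau ^+ (k + r))) ?rpredX //; last first.
  by apply: cp3_2 => //; apply: hybrid_cp3; rewrite rpredX ?uO_Oi.
rewrite -[LHS](@A2_scale_y _ (tau ^+ p)) //; last first.
  move=> n x x' y y' xx yy; apply: hybrid_cp3; rewrite ?rpredX ?uO_Oi //.
    by apply: eqmM => //; rewrite eqm_refl // rpredX // uO_Oi.
  exact: eqm_refl.
apply: eq_A2 => x y _ _; rewrite /hybrid mulrDr; congr (_ + _).
  by rewrite exprMn -!exprM mulnC.
rewrite mul1r mulrCA exprMn [in RHS]mulrA; set T := tau ^+ p.
rewrite -!mulrA !mulr_sumr; apply: eq_big_nat => i /andP[_ ik].
rewrite -mulrBr !exprMn (_ : k + r = r + i + (k - i))%N; last by lia.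
by rewrite !exprD; ring.
Qed.

Section HybridPolynomial.
Variables (p : nat) (charK : p \in [pchar K]).
Variables (k r l : nat).
Hypotheses (r_gt0 : (0 < r)%N) (l_gt0 : (0 < l)%N).
Hypothesis p_dvd : (p %| r + l + k)%N.

Let e := ((r + l + k) %/ p)%N.
Let dE : (r + l + k = p * e)%N. Proof. by rewrite mulnC divnK. Qed.
Let p_prime : prime p. Proof. exact: pcharf_prime charK. Qed.
Let p_gt0 : (0 < p)%N. Proof. exact: prime_gt0. Qed.

Let binC i : K := 'C(k + r, i + r)%:R.

(* gzero = 'X^r * wzero is the dehomogenization g(y,1); 'X^l * winf is g(1,z); and
   gzero = 1 + Y^(k+1) * wone at y = 1 + Y. *)
Definition wzero : {poly K} :=
  \sum_(0 <= i < k.+1) binC i *: ('X^i * (1 - 'X) ^+ (k - i)).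
Definition gzero : {poly K} := 'X^r * wzero.
Definition winf : {poly K} :=
  \sum_(0 <= i < k.+1) binC i *: ('X - 1) ^+ (k - i).
Definition wone : {poly K} :=
  - \sum_(0 <= j < r) ('C(k + r, j)%:R * (-1) ^+ (k + r - j))
      *: (('X + 1) ^+ j * 'X^(r.-1 - j)).

Lemma wzero_Oi : wzero \is a polyOver Oi.
Proof.
apply: rpred_sum => i _; rewrite polyOverZ ?rpred_nat // rpredM ?rpredX ?polyOverX //.
by rewrite rpredB ?polyOverX ?rpred1.
Qed.

Lemma winf_Oi : winf \is a polyOver Oi.
Proof.
apply: rpred_sum => i _; rewrite polyOverZ ?rpred_nat // rpredX //.
by rewrite rpredB ?polyOverX ?rpred1.
Qed.

Lemma wone_Oi : wone \is a polyOver Oi.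
Proof.
rewrite rpredN; apply: rpred_sum => i _; rewrite polyOverZ //.
  by rewrite rpredM ?rpred_nat ?rpredX ?rpredN ?rpred1.
by rewrite rpredM ?rpredX ?polyOverX // rpredD ?polyOverX ?rpred1.
Qed.

Lemma gzero_Oi : gzero \is a polyOver Oi.
Proof. by rewrite rpredM ?wzero_Oi ?rpredX ?polyOverX. Qed.

Lemma wzeroE y : wzero.[y] = \sum_(0 <= i < k.+1) binC i * y ^+ i * (1 - y) ^+ (k - i).
Proof.
rewrite horner_sum; apply: eq_bigr => i _.
by rewrite hornerZ hornerM hornerXn horner_exp hornerD hornerN hornerX hornerC mulrA.
Qed.

Lemma winfE y : winf.[y] = \sum_(0 <= i < k.+1) binC i * (y - 1) ^+ (k - i).
Proof.
rewrite horner_sum; apply: eq_bigr => i _.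
by rewrite hornerZ horner_exp hornerD hornerN hornerX hornerC.
Qed.

Lemma gzeroE y : gzero.[y] = y ^+ r * wzero.[y].
Proof. by rewrite hornerM hornerXn. Qed.

Lemma hybrid_zchart x y z :
  hybrid p k r l 1 (z ^+ e * x) (z * y) z = z ^+ (r + l + k) * (x ^+ p + gzero.[y]).
Proof.
rewrite /hybrid mulrDr gzeroE wzeroE; congr (_ + _).
  by rewrite exprMn -exprM dE mulnC.
rewrite mul1r -!mulrA !mulr_sumr; apply: eq_big_nat => i /andP[_ ik].
have -> : z - z * y = z * (1 - y) by ring.
rewrite !exprMn (_ : r + l + k = r + l + i + (k - i))%N; last by lia.
by rewrite !exprD /binC; ring.
Qed.

Lemma hybrid_ychart x y z :
  hybrid p k r l 1 (y ^+ e * x) y (y * z) = y ^+ (r + l + k) * (x ^+ p + z ^+ l * winf.[z]).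
Proof.
rewrite /hybrid mulrDr winfE; congr (_ + _).
  by rewrite exprMn -exprM dE mulnC.
rewrite mul1r -!mulrA !mulr_sumr; apply: eq_big_nat => i /andP[_ ik].
have -> : y * z - y = y * (z - 1) by ring.
rewrite !exprMn (_ : r + l + k = r + l + i + (k - i))%N; last by lia.
by rewrite !exprD /binC; ring.
Qed.

Lemma hybrid_scale u x y z : hybrid p k r l 1 x (u * y) (u * z) =
  x ^+ p + u ^+ (r + l + k) * (hybrid p k r l 1 0 y z).
Proof.
rewrite /hybrid expr0n gtn_eqF // add0r; congr (_ + _).
rewrite !mul1r !mulr_sumr; apply: eq_big_nat => i /andP[_ ik].
rewrite -mulrBr !exprMn (_ : r + l + k = r + l + i + (k - i))%N; last by lia.
by rewrite !exprD; ring.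
Qed.

Lemma hybrid0 x y z : hybrid p k r l 1 x y z = x ^+ p + hybrid p k r l 1 0 y z.
Proof. by rewrite /hybrid expr0n gtn_eqF // add0r. Qed.

(** In the expansion of [((1 - y) + y)^(k+r) = 1], the terms with exponent of [y] at least [r] add
    up to [gzero]. The remaining ones are all divisible by [(1 - y)^(k+1)]. *)
Lemma gzero_one Y : gzero.[1 + Y] = 1 + Y ^+ k.+1 * wone.[Y].
Proof.
have shift (F : nat -> K) :
    \sum_(r <= i < (k + r).+1) F i = \sum_(0 <= i < k.+1) F (i + r)%N.
  by rewrite -{1}[r]add0n big_addn (_ : (k + r).+1 - r = k.+1)%N //; lia.
have := exprDn (1 - (1 + Y)) (1 + Y) (k + r).
rewrite subrK expr1n -(big_mkord xpredT
  (fun i => ((1 - (1 + Y)) ^+ (k + r - i) * (1 + Y) ^+ i) *+ 'C(k + r, i))).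
rewrite (@big_cat_nat _ _ _ r) //=; last by lia.
rewrite shift => h; rewrite gzeroE wzeroE.
have -> : (1 + Y) ^+ r * (\sum_(0 <= i < k.+1) binC i * (1 + Y) ^+ i * (1 - (1 + Y)) ^+ (k - i))
   = \sum_(0 <= i < k.+1)
       ((1 - (1 + Y)) ^+ (k + r - (i + r)) * (1 + Y) ^+ (i + r)) *+ 'C(k + r, i + r).
  rewrite mulr_sumr; apply: eq_bigr => i _.
  by rewrite subnDr exprD -[RHS]mulr_natr /binC; ring.
move: h; set S2 := \sum_(0 <= i < k.+1) _; set S1 := \sum_(0 <= i < r) _ => h.
have -> : S2 = 1 - S1 by rewrite h addrAC subrr add0r.
rewrite /S1.
rewrite hornerN horner_sum mulrN mulr_sumr; congr (_ - _).
apply: eq_big_nat => j /andP[_ jr].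
have -> : 1 - (1 + Y) = -1 * Y by ring.
rewrite hornerZ hornerM !horner_exp hornerD hornerX hornerC exprMn -mulr_natr.
have -> : Y ^+ (k + r - j) = Y ^+ k.+1 * Y ^+ (r.-1 - j).
  by rewrite -exprD; congr (_ ^+ _); lia.
by rewrite [1 + Y]addrC; ring.
Qed.

Lemma deriv_gzero :
  gzero^`() = (r * 'C(k + r, r))%:R *: ('X^(r.-1) * (1 - 'X) ^+ k).
Proof.
(* [A i] is the part of the derivative of summand [i] that differentiates the power of ['X]. The
   part from [1 - 'X] is [- A i.+1], because [(n - m) C(n,m) = (m + 1) C(n,m+1)]. The last term
   [A k.+1] has binomial coefficient 0. *)
pose A i : {poly K} := ((i + r) * 'C(k + r, i + r))%:R *:
  ('X^((i + r).-1) * (1 - 'X) ^+ (k - i)).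
have -> : gzero = \sum_(0 <= i < k.+1) binC i *: ('X^(i + r) * (1 - 'X) ^+ (k - i)).
  rewrite /gzero /wzero mulr_sumr; apply: eq_bigr => i _.
  by rewrite -scalerAr mulrA -exprD addnC.
rewrite raddf_sum /=.
transitivity (\sum_(0 <= i < k.+1) (A i - A i.+1)).
  apply: eq_big_nat => i /andP[_ ik].
  rewrite derivZ derivM derivXn deriv_exp derivB derivX derivC sub0r.
  have -> : A i.+1 = ((k - i) * 'C(k + r, i + r))%:R *:
      ('X^(i + r) * (1 - 'X) ^+ (k - i).-1).
    rewrite /A addSn mul_bin_left (_ : k + r - (i + r) = k - i)%N; last by lia.
    by rewrite /= (_ : k - i.+1 = (k - i).-1)%N //; lia.
  have mn (f : {poly K}) n : f *+ n = n%:R%:P * f by rewrite mul_polyC scaler_nat.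
  by rewrite /A /binC !mn -!mul_polyC !natrM !polyCM; ring.
rewrite (eq_bigr (fun i => - (A i.+1 - A i))) => [|i _]; last by rewrite opprB.
rewrite sumrN telescope_sumr // opprB {2}/A bin_small ?muln0 ?scale0r ?subr0; last by lia.
by rewrite /A add0n subn0.
Qed.

(** * The case where p divides the binomial coefficient *)

Section Degenerate.
Hypothesis p_dvd_bin : (p %| 'C(k + r, r))%N.

(** The derivative vanishes, so only exponents divisible by [p] occur. The coefficients come from
    the prime field and are fixed by Frobenius, hence are their own [p]-th powers. *)
Lemma gzero_pth_power u : exists h, gzero.[u] = h ^+ p.
Proof.
have d0 : gzero^`() = 0.
  rewrite deriv_gzero; have /dvdnP[a ->] := p_dvd_bin.
  by rewrite !natrM (pcharf0 charK) !mulr0 scale0r.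
have c0 i : ~~ (p %| i)%N -> gzero`_i = 0.
  case: i => [|i]; first by rewrite dvdn0.
  move=> /(natr_uO charK)/uO_neq0 i0; apply/eqP.
  have := coef_deriv gzero i; rewrite d0 coef0 => /esym/eqP.
  by rewrite -mulr_natr mulf_eq0 (negPf i0) orbF.
have fix_frob : map_poly (pFrobenius_aut charK) gzero = gzero.
  rewrite /gzero /wzero rmorphM rmorph_sum /= map_polyXn; congr (_ * _).
  apply: eq_bigr => i _; rewrite map_polyZ rmorphM /= map_polyXn rmorphXn /=.
  by rewrite rmorphB rmorph1 /= map_polyX rmorph_nat.
pose h := \sum_(i < size gzero) gzero`_i * u ^+ (i %/ p).
exists h; rewrite -pFrobenius_autE rmorph_sum horner_coef /=.
apply: eq_bigr => i _; rewrite rmorphM /= -coef_map fix_frob pFrobenius_autE.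
have [pi'|/c0 ->] := boolP (p %| i)%N; last by rewrite !mul0r.
by rewrite -exprM divnK.
Qed.

(** The translation of [x] is made for fixed [y] and [z]. For [z = 0] dehomogenization is
    impossible, but there the second summand vanishes. Although [y / z] need not be integral, [h]
    is, because [h ^+ p] is. *)
Lemma hybrid_pth_power y z : y \in Oi -> z \in Oi ->
  exists2 h, h \in Oi & forall x, hybrid p k r l 1 x y z = (x + h) ^+ p.
Proof.
move=> yO zO; suff [h hE] : exists h, hybrid p k r l 1 0 y z = h ^+ p.
  exists h => [|x]; last by rewrite hybrid0 hE exprDn_pchar // pnatE.
  apply: (Oi_root p_gt0); rewrite -hE.
  apply: (@eqm_Oil 0 _ (hybrid p k r l 1 0 y z)).
  by apply: hybrid_cp3; rewrite ?rpred1 ?eqm_refl ?rpred0.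
have [->|z0] := eqVneq z 0.
  exists 0; rewrite /hybrid !expr0n !gtn_eqF //.
  by rewrite mulr0 mul0r addr0.
have [h hE] := gzero_pth_power (y / z); exists (z ^+ e * h).
have := hybrid_zchart 0 (y / z) z; rewrite mulr0 expr0n gtn_eqF // add0r.
by rewrite mulrC divfK // => ->; rewrite hE exprMn -exprM dE mulnC.
Qed.

Lemma degenerate_gf :
  gf (1 - q%:R^-1 *: 'X^p) (A1 0 (fun x => x ^+ p))%:P
     (fun m => A3 m (hybrid p k r l 1)).
Proof.
have cpX : cp1 (fun x => x ^+ p) by move=> n x x' xx; apply: eqmX.
have E m : A3 m (hybrid p k r l 1) = A1 m (fun x => x ^+ p).
  rewrite -[RHS](avg_cst (m + M)); apply: eq_avg => z zO.
  rewrite A2_swap -[RHS](avg_cst (m + M)); apply: eq_avg => y yO.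
  have [h hO hE] := hybrid_pth_power yO zO.
  apply: etrans (avg_shift hO (phi_inv (m := m) cpX)).
  by apply: eq_avg => x _; rewrite hE.
rewrite -[X in gf X]mul1r; apply: (@gf_rec _ _ _ _ _ B) => [m|].
  exact: A3_norm.
have -> : (A1 0 (fun x => x ^+ p))%:P = \poly_(m < 1) (A3 m (hybrid p k r l 1) -
   q%:R^-1 * (if (p <= m)%N then A3 (m - p) (hybrid p k r l 1) else 0)).
  apply/polyP => -[|i]; rewrite coefC coef_poly //=.
  by rewrite leqNgt p_gt0 mulr0 subr0 E.
apply: gf_fin => m m_gt0; rewrite !E A1_split // big1_seq ?add0r.
  rewrite -A1_pi //; apply/eqP; rewrite subr_eq0; apply/eqP; congr (_ * _).
  by apply: eq_A1 => x _; rewrite exprMn.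
move=> s /andP[su _]; rewrite -[RHS](@A1_unit0 m 0 (fun x => (s + pi * x) ^+ p)) //.
  by apply: eq_A1 => x _; rewrite mul1r.
by move=> x xO; rewrite rpredX // uO_addl // mI_piS mI0.
Qed.
End Degenerate.

Lemma A1_pow_trivial : (forall u, u \in uO -> chi u ^+ p = 1) ->
  A1 0 (fun x => x ^+ p) = 1 - q%:R^-1.
Proof.
move=> chip.
have E x : x \in Oi -> phi 0 (x ^+ p) = 1 - (x \in mI 1)%:R.
  move=> xO; rewrite -[x \in mI 1]negbK -uO_notin_mI // /phi phi_cond expr0 divr1.
  have [xu|xu] := boolP (x \in uO).
    by rewrite rpredX // (chi_X chi_char) // chip // subr0.
  rewrite ifF ?subrr //; apply/negP; move: xu; rewrite uO_notin_mI // negbK => x1.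
  move/uO_ndiv; rewrite -(prednK p_gt0) exprS mIMr // rpredX //.
rewrite /A1 (eq_avg _ E) add0n.
have -> : avg M (fun x => 1 - (x \in mI 1)%:R) =
    avg M (fun=> 1) + -1 * avg M (fun x => (x \in mI 1)%:R).
  by rewrite -avgZ -avgD; apply: eq_avg => x _; rewrite mulN1r.
rewrite mulN1r !avg_cst; congr (_ - _).
rewrite -(prednK M_gt0) avg_split.
  rewrite big1_seq ?add0r => [|s /andP[su _]].
    rewrite -[RHS]mulr1 -[X in _ = _ * X](avg_cst M.-1); congr (_ * _).
    by apply: eq_avg => x xO; rewrite mI_piS mI0 xO.
  rewrite -[RHS](avg_cst M.-1); apply: eq_avg => x xO.
  by rewrite (negPf (uO_ndiv _)) // uO_addl // mI_piS mI0.
move=> x y xO yO xy; congr (_ %:R); congr nat_of_bool.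
have {}xy : x - y \in mI 1 by apply: mI_le xy.
by apply: negb_inj; rewrite -!uO_notin_mI //; apply: uO_congr.
Qed.

(** Replacing [x] by [u * x] preserves the average and also multiplies it by [chi u ^+ p]. *)
Lemma A1_pow_nontrivial u : u \in uO -> chi u ^+ p != 1 ->
  A1 0 (fun x => x ^+ p) = 0.
Proof.
move=> uu chiu.
have cpX : cp1 (fun x => x ^+ p) by move=> n x x' xx; apply: eqmX.
have := A1_scale 0 cpX uu.
rewrite (eq_A1 0 (G := fun x => u ^+ p * x ^+ p)) => [|x _]; last by rewrite exprMn.
rewrite A1_unit ?rpredX // (chi_X chi_char) // => /eqP.
rewrite -subr_eq0 -{2}[A1 _ _]mul1r -mulrBl mulf_eq0 subr_eq0 (negPf chiu).
by move/eqP.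
Qed.

(** * The case where p does not divide the binomial coefficient *)

Section Nondegenerate.
Hypotheses (k_gt0 : (0 < k)%N) (p_ndvd_r : ~~ (p %| r)%N) (p_ndvd_l : ~~ (p %| l)%N).
Hypothesis residues_le : (r %% p + l %% p <= p)%N.
Hypothesis p_ndvd_bin : ~~ (p %| 'C(k + r, r))%N.

(** This is the purpose of [residues_le]. If [p] divided [k + 1], it would divide [r + l - 1], which
    is congruent to the sum of the two residues minus 1, a number between 1 and [p - 1]. *)
Lemma p_ndvd_k1 : ~~ (p %| k.+1)%N.
Proof.
apply/negP => pk.
have r1 : (0 < r %% p)%N by rewrite lt0n.
have l1 : (0 < l %% p)%N by rewrite lt0n.
have rlE : (r + l).-1 = ((r %/ p + l %/ p) * p + (r %% p + l %% p).-1)%N.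
  by rewrite {1}(divn_eq r p) {1}(divn_eq l p) mulnDl; lia.
have : (p %| (r + l).-1)%N.
  rewrite -(dvdn_addl _ pk) (_ : (r + l).-1 + k.+1 = r + l + k)%N //; lia.
rewrite rlE dvdn_addr ?dvdn_mull // => /dvdn_leq h.
have := h (ltac:(lia)); lia.
Qed.

Let Csign n : (-1 : K) ^+ n \in uO.
Proof. by rewrite rpredX // uON ?rpred1. Qed.

Lemma wzero0_unit : wzero.[0] \in uO.
Proof.
rewrite wzeroE big_nat_recl // big1 ?addr0 => [|i _].
  by rewrite mulr1 subr0 expr1n mulr1 /binC add0n (natr_uO charK).
by rewrite expr0n mulr0 mul0r.
Qed.

(** Only the term [j = r - 1] survives, giving [C(k+r,r-1)] up to sign. It is prime to [p] because
    [(k+1) C(k+r,r-1) = r C(k+r,r)]. *)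
Lemma wone0_unit : wone.[0] \in uO.
Proof.
rewrite hornerN horner_sum uON //.
have -> : r = r.-1.+1 by rewrite prednK.
rewrite big_nat_recr //= big_nat big1 ?add0r => [|j /andP[_ jr]].
  rewrite hornerZ hornerM subnn expr0 hornerC mulr1 horner_exp.
  rewrite hornerD hornerX hornerC add0r expr1n mulr1 prednK //.
  rewrite rpredM // (natr_uO charK) //.
  apply: contra p_ndvd_bin => h.
  have := mul_bin_left (k + r) r.-1; rewrite prednK // => e1.
  have : (p %| r * 'C(k + r, r))%N by rewrite e1 dvdn_mull.
  by rewrite Euclid_dvdM // (negPf p_ndvd_r).
rewrite hornerZ hornerM hornerXn (_ : r.-1 - j = (r.-1 - j).-1.+1)%N; last by lia.
by rewrite expr0n !mulr0.
Qed.

Lemma alternating_bin n m :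
  \sum_(0 <= i < m.+1) (-1) ^+ i * 'C(n.+1, i)%:R = (-1) ^+ m * 'C(n, m)%:R :> K.
Proof.
elim: m => [|m IHm]; first by rewrite big_nat1 !bin0.
by rewrite big_nat_recr //= IHm binS natrD exprS; ring.
Qed.

(** The value is an alternating partial sum of a row of binomial coefficients, hence [C(k+r-1,k)] up
    to sign. It is prime to [p] because [(k+r) C(k+r-1,r-1) = r C(k+r,r)]. *)
Lemma winf0_unit : winf.[0] \in uO.
Proof.
have -> : winf.[0] = (-1) ^+ k * 'C((k + r).-1, k)%:R.
  rewrite -alternating_bin prednK; last by lia.
  rewrite winfE big_nat_rev /=; apply: eq_big_nat => i /andP[_ ik].
  rewrite add0n subSS sub0r (_ : k - (k - i) = i)%N; last by lia.
  rewrite mulrC /binC -(bin_sub (n := k + r) (m := i)); last by lia.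
  by congr (_ * _%:R); congr 'C(_, _); lia.
rewrite rpredM // (natr_uO charK) //.
apply: contra p_ndvd_bin => h.
have := mul_bin_diag (k + r) r.-1; rewrite prednK //.
rewrite -(bin_sub (n := (k + r).-1) (m := r.-1)); last by lia.
rewrite (_ : (k + r).-1 - r.-1 = k)%N; last by lia.
move=> e1; have : (p %| r * 'C(k + r, r))%N by rewrite -e1 dvdn_mull.
by rewrite Euclid_dvdM // (negPf p_ndvd_r).
Qed.

Let Qsm : {poly C} := 1 - q%:R^-1 *: 'X^1.
Let Pa a : {poly C} := 1 - (q%:R ^+ (p + a))^-1 *: 'X^(p * a).
(** A common denominator for all discs of both charts. Each disc needs [Qsm] and at most one factor
    [Pa a]. *)
Let Q0 : {poly C} := Qsm * \prod_(a <- undup [:: r; l; k.+1]) Pa a.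

Let Q0_sm c : gfE Qsm c -> gfE Q0 c. Proof. exact: gfE_mul. Qed.

Let Q0_sing a c : a \in [:: r; l; k.+1] -> gfE (Qsing p a) c -> gfE Q0 c.
Proof.
rewrite -mem_undup => ain h; apply: gfE_dvd h _.
exists (\prod_(b <- rem a (undup [:: r; l; k.+1])) Pa b).
by rewrite /Q0 (big_rem a) //= mulrA.
Qed.

Let ndvd_coprime a : ~~ (p %| a)%N -> coprime p a.
Proof. by move=> h; rewrite prime_coprime. Qed.

Lemma bzero_gf : gfE Q0 (fun m => A2 m (fun x y => x ^+ p + gzero.[y])).
Proof.
have cpF : cp2 (fun x y => x ^+ p + gzero.[y]).
  move=> n x x' y y' xx yy; apply: eqmD; first exact: eqmX.
  by apply: eqm_horner; first exact: gzero_Oi.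
apply: (gfE_ext (c := fun m => q%:R^-1 *
    (\sum_(s <- rs | s \in uO) A2 m (fun x y => x ^+ p + gzero.[s + pi * y])
     + A2 m (fun x Y => x ^+ p + (pi * Y) ^+ r * wzero.[pi * Y])))).
  move=> m; rewrite (A2_split_y m cpF); congr (_ * (_ + _)).
  by apply: eq_A2 => x y _ _; rewrite gzeroE.
apply: gfE_scale; apply: gfE_add; last first.
  apply: (@Q0_sing r); first by rewrite mem_head.
  by apply: (singular_gf p_gt0 r_gt0 _ _ wzero0_unit wzero_Oi) => //;
    rewrite ?ndvd_coprime ?(natr_uO charK).
apply: gfE_sum => s su; have sO := uO_Oi su.
(* For unit [s], the derivative [r C(k+r,r) s^(r-1) (1-s)^k] is a unit unless [s] is congruent to
   1. *)
have [s1|s1] := boolP (1 - s \in uO).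
  have [w [wO w0 wE]] := horner_taylor gzero_Oi sO.
  apply: Q0_sm.
  apply: gfE_ext (smooth_gf wO (E := fun x => x ^+ p + gzero.[s]) _ _).
  - by move=> m; apply: eq_A2 => x y xO yO; rewrite wE addrA.
  - rewrite w0 deriv_gzero hornerZ hornerM hornerXn horner_exp hornerD hornerN.
    rewrite hornerX hornerC rpredM ?(natr_uO charK) // ?rpredM ?rpredX //.
    by rewrite Euclid_dvdM // negb_or p_ndvd_r.
  - move=> n x x' xx; apply: eqmD; first exact: eqmX.
    by rewrite eqm_refl // horner_Oi ?gzero_Oi.
have {}s1 : s - 1 \in mI 1.
  rewrite -opprB rpredN; move: s1; rewrite uO_notin_mI ?negbK //.
  by rewrite rpredB ?rpred1.
have [d dO dE'] := mIP _ _ s1.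
pose Fs x Y := x ^+ p + (pi * Y) ^+ k.+1 * wone.[pi * Y].
have cpFs : cp2 Fs.
  move=> n x x' y y' xx yy; apply: eqmD; first exact: eqmX.
  have h := cp1_pi yy; apply: eqmM; first exact: eqmX.
  by apply: eqm_horner; first exact: wone_Oi.
apply: (gfE_ext (c := fun m => A2 m Fs)).
  (* Shifting [y] by [d] moves the centre of the disc from [s] to 1. Shifting [x] by 1 absorbs the
     value 1 of [gzero] there, as [(x + 1)^p = x^p + 1]. *)
  move=> m; rewrite -(A2_shift_y m cpFs dO) -(@A2_shift_x _ 1) ?rpred1 //.
    apply: eq_A2 => x y _ _; rewrite /Fs.
    have -> : s + pi * y = 1 + pi * (y + d).
      by rewrite -[s](subrK 1) dE' expr1; ring.
    by rewrite gzero_one exprDn_pchar ?pnatE // expr1n addrA.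
  move=> n x x' y y' xx yy; apply: cpFs => //; apply: eqmD => //.
  exact: eqm_refl.
apply: (@Q0_sing k.+1); first by rewrite !inE eqxx !orbT.
by apply: (singular_gf p_gt0 _ _ _ wone0_unit wone_Oi) => //;
  rewrite ?ndvd_coprime ?(natr_uO charK) ?p_ndvd_k1.
Qed.

Lemma binf_gf : gfE Q0
  (fun m => A2 m (fun x z => x ^+ p + (pi * z) ^+ l * winf.[pi * z])).
Proof.
apply: (@Q0_sing l); first by rewrite !inE eqxx orbT.
by apply: (singular_gf p_gt0 l_gt0 _ _ winf0_unit winf_Oi) => //;
  rewrite ?ndvd_coprime ?(natr_uO charK).
Qed.

(** This is [q] times the integral of [chi (u^d)] over the units, [d = r + l + k]: the contribution
    of the coordinate that is a unit in a chart. *)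
Let kappa : C :=
  \sum_(s <- rs | s \in uO) avg M (fun z => chi ((s + pi * z) ^+ (r + l + k))).

Let uO_sX s x : s \in uO -> x \in Oi -> s + pi * x \in uO.
Proof. by move=> su xO; apply: uO_addl; rewrite ?mI_piS ?mI0. Qed.

(** For each unit value [u] of the last coordinate, the measure preserving substitution
    [(u^e x, u y)] extracts [u^d]. What remains is free of [u], so the integral factors. *)
Let unit_part m F G : cp3 F ->
  (forall u x y, u \in uO -> F (u ^+ e * x) (u * y) u = u ^+ (r + l + k) * G x y) ->
  \sum_(s <- rs | s \in uO) A3 m (fun x y z => F x y (s + pi * z)) =
  kappa * A2 m G.
Proof.
move=> cpF FG; rewrite mulr_suml; apply: eq_bigr => s su.
have lift : avg (m + M) (fun z => chi ((s + pi * z) ^+ (r + l + k))) =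
    avg M (fun z => chi ((s + pi * z) ^+ (r + l + k))).
  apply: avg_lift; first exact: leq_addl.
  have phiE x : x \in Oi ->
      chi ((s + pi * x) ^+ (r + l + k)) = phi 0 ((s + pi * x) ^+ (r + l + k)).
    by move=> xO; rewrite /phi phi_cond expr0 divr1 rpredX ?uO_sX.
  move=> x y xO yO xy; rewrite !phiE //.
  apply: (phi_inv (m := 0) (F := fun x => (s + pi * x) ^+ (r + l + k)));
    rewrite ?add0n //.
  move=> n a b ab; apply: eqmX; apply: eqmD; last exact: cp1_pi.
  by rewrite eqm_refl // uO_Oi.
rewrite -lift -avgZr; apply: eq_avg => z zO; have uu := uO_sX su zO.
set u := s + pi * z in uu *; have uO' := uO_Oi uu.
have cpu := cp3_2 cpF uO'.
rewrite -(A2_scale_x m cpu (rpredX e uu)) -(@A2_scale_y m u) //; last first.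
  move=> n x x' y y' xx yy; apply: cpu => //; apply: eqmM => //.
  by rewrite eqm_refl // rpredX.
rewrite -A2_unit ?rpredX //.
by apply: eq_A2 => x y _ _; rewrite FG.
Qed.

Let hyb : K -> K -> K -> K := hybrid p k r l 1.
Let hyb_cp : cp3 hyb. Proof. by apply: hybrid_cp3; rewrite rpred1. Qed.

Let Hj j m := A3 m (fun x y z => x ^+ p + pi ^+ (p * j) * hyb 0 y z).

Let Hj_cp j : cp3 (fun x y z => x ^+ p + pi ^+ (p * j) * hyb 0 y z).
Proof.
move=> n x x' y y' z z' xx yy zz; apply: eqmD; first exact: eqmX.
apply: eqmM; first by rewrite eqm_refl ?rpredX ?piO.
by apply: hyb_cp => //; rewrite eqm_refl ?rpred0.
Qed.

(** The second summand is divisible by [pi], so a unit [x] gives order 0. Otherwise [x] contributes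
    a factor [pi], and [pi^p] can be extracted. *)
Let Hj_step j m : (0 < m)%N ->
  Hj j.+1 m = q%:R^-1 * (if (p <= m)%N then Hj j (m - p) else 0).
Proof.
move=> m0; rewrite {1}/Hj A3_split_x; last exact: Hj_cp.
rewrite big1_seq ?add0r => [|s /andP[su _]].
  rewrite -A3_pi; last exact: Hj_cp.
  congr (_ * _); apply: eq_A3 => x y z _ _ _.
  by rewrite mulnS exprD exprMn; ring.
rewrite -[RHS](@A3_unit0 m 0
  (fun x y z => (s + pi * x) ^+ p + pi ^+ (p * j.+1) * hyb 0 y z)) //.
  by apply: eq_A3 => x y z _ _ _; rewrite mul1r.
move=> x y z xO yO zO; apply: uO_addl; first by rewrite rpredX ?uO_sX.
rewrite (@mI_le 1 (p * j.+1)) ?muln_gt0 ?p_gt0 // mIX.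
apply: (@eqm_Oil 0 _ (hyb 0 y z)).
by apply: hyb_cp; rewrite eqm_refl ?rpred0.
Qed.

Let Hj_iter j : exists m0, forall m, (m0 <= m)%N -> Hj j m =
  (q%:R ^+ j)^-1 * (if (p * j <= m)%N then A3 (m - p * j) hyb else 0).
Proof.
elim: j => [|j [m0 hm0]].
  exists 0%N => m _; rewrite muln0 subn0 expr0 invr1 mul1r.
  by apply: eq_A3 => x y z _ _ _; rewrite muln0 mul1r -hybrid0.
exists (m0 + p)%N => m hm; rewrite Hj_step; last by lia.
rewrite (_ : p <= m)%N; last by lia.
rewrite hm0; last by lia.
rewrite exprS invfM mulrA mulnS leq_subRL; last by lia.
by rewrite subnDA.
Qed.

(** The three terms are the regions where [z] is a unit, where only [y] is a unit among the two, and
    where both are divisible by [pi]. On the last, homogeneity extracts [pi^d = pi^(p e)] from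
    [g]. *)
Let hyb_split m : A3 m hyb = q%:R^-1 *
  (kappa * A2 m (fun x y => x ^+ p + gzero.[y])
   + q%:R^-1 * (kappa * A2 m (fun x z => x ^+ p + (pi * z) ^+ l * winf.[pi * z])
                + Hj e m)).
Proof.
have cpz : cp3 (fun x y z => hyb x y (pi * z)).
  by move=> n x x' y y' z z' xx yy zz; apply: hyb_cp => //; apply: cp1_pi.
rewrite (A3_split_z m hyb_cp).
rewrite (unit_part m (G := fun x y => x ^+ p + gzero.[y]) hyb_cp);
  last by move=> u x y _; apply: hybrid_zchart.
congr (_ * (_ + _)); rewrite (A3_split_y m cpz); congr (_ * (_ + _)); last first.
  by apply: eq_A3 => x y z _ _ _; rewrite /hyb hybrid_scale dE.
(* In the second chart [y] and [z] trade places, so that the unit coordinate comes last. *)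
rewrite -(@unit_part m (fun x z y => hyb x y (pi * z)) _).
- by apply: eq_bigr => s _; rewrite A3_swap.
- by move=> n x x' y y' z z' xx yy zz; apply: cpz.
- by move=> u x y uu; rewrite /= mulrCA /hyb hybrid_ychart.
Qed.

Definition hybrid_den : {poly C} :=
  (1 - q%:R^-1 *: 'X^1) *
  (1 - (q%:R ^+ (e + 2))^-1 *: 'X^(r + l + k)) *
  \prod_(a <- undup [:: r; l; k.+1]) (1 - (q%:R ^+ (p + a))^-1 *: 'X^(p * a)).

Lemma nondegenerate_gf : gfE hybrid_den (fun m => A3 m hyb).
Proof.
have -> : hybrid_den = Q0 * (1 - (q%:R ^+ (e + 2))^-1 *: 'X^(r + l + k)).
  by rewrite /hybrid_den mulrAC.
apply: (gfE_rec (B := B)) => [m|]; first exact: A3_norm.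
have [m0 hm0] := Hj_iter e.
have collect (a b c x y z : C) :
    a * (b * x + a * (b * y + c * z)) - c * (a * a) * z = a * b * x + a * a * b * y.
  by ring.
apply: (@gfE_eventually _ _ _ (fun m =>
   q%:R^-1 * kappa * A2 m (fun x y => x ^+ p + gzero.[y]) +
   q%:R^-1 * q%:R^-1 * kappa *
     A2 m (fun x z => x ^+ p + (pi * z) ^+ l * winf.[pi * z])) m0) => [m hm|].
  (* Dividing [y] and [z] by [pi] costs [q^-2], and the [e] divisions of [x] cost [q^-e]. *)
  rewrite {1}hyb_split hm0 // -dE [q%:R ^+ (e + 2)]exprD invfM expr2 invfM.
  exact: collect.
by apply: gfE_add; apply: gfE_scale; [exact: bzero_gf | exact: binf_gf].
Qed.
End Nondegenerate.
End HybridPolynomial.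

(** * Haar measure *)

Section HaarMeasure.
Variables (mu : {measure set (borelK3 K) -> \bar R}) (mu_haar : normalized_haar mu).
Local Notation K3 := (K * K * K)%type.

Definition coset n (t : K3) : set K3 :=
  [set w | [/\ w.1.1 - t.1.1 \in mI n, w.1.2 - t.1.2 \in mI n & w.2 - t.2 \in mI n]].

Definition triples n : seq K3 :=
  [seq (u, c) | c <- digits n, u <- [seq (a, b) | a <- digits n, b <- digits n]].

Lemma open_ball n a : open [set x : K | x - a \in mI n].
Proof.
rewrite openE => x /= xa; apply/nbhs_ordE; exists n%:Z => y /vballE yx /=.
by rewrite -[y](subrK x) -addrA rpredD.
Qed.

Lemma measurable_coset n t : measurable (coset n t : set (borelK3 K)).
Proof.
apply: sub_sigma_algebra.
have -> : coset n t =
    (fst \o fst) @^-1` [set x | x - t.1.1 \in mI n] `&`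
    ((snd \o fst) @^-1` [set x | x - t.1.2 \in mI n] `&`
     snd @^-1` [set x | x - t.2 \in mI n]).
  by apply/seteqP; split => w; [case=> ? ? ?; split | case=> ? [? ?]; split].
apply: openI; first by apply: open_comp (open_ball _ _) => w _;
  apply: continuous_comp; apply: cvg_fst.
apply: openI; last by apply: open_comp (open_ball _ _) => w _; apply: cvg_snd.
by apply: open_comp (open_ball _ _) => w _;
  apply: continuous_comp; [apply: cvg_fst | apply: cvg_snd].
Qed.

Lemma mem_triples n t : (t \in triples n) =
  [&& t.1.1 \in digits n, t.1.2 \in digits n & t.2 \in digits n].
Proof.
apply/allpairsP/and3P => [[[c u] /= [cD /allpairsP[[a b] /= [aD bD ->]] ->]]//|].
case: t => [[a b] c] /= [aD bD cD]; exists (c, (a, b)); split => //.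
by apply/allpairsP; exists (a, b).
Qed.

Lemma triples_uniq n : uniq (triples n).
Proof.
apply: allpairs_uniq; rewrite ?digits_uniq //.
  by apply: allpairs_uniq; rewrite ?digits_uniq // => -[? ?] [? ?] _ _ [-> ->].
by move=> [? ?] [? ?] _ _ [-> ->].
Qed.

Lemma triples_size n : size (triples n) = (q ^ n * (q ^ n * q ^ n))%N.
Proof. by rewrite !size_allpairs !digits_size. Qed.

Lemma triples_trivIset n : trivIset [set` triples n] (coset n).
Proof.
move=> [[a b] c] [[a' b'] c'] /=; rewrite !mem_triples /=.
move=> /and3P[aD bD cD] /and3P[a'D b'D c'D] [w [/= [h1 h2 h3] [h1' h2' h3']]].
have E x y z : x \in digits n -> y \in digits n -> z - x \in mI n ->
    z - y \in mI n -> x = y.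
  move=> xD yD zx zy; apply: (digits_inj xD yD).
  have -> : x - y = (z - y) - (z - x) by ring.
  exact: rpredB.
by rewrite (E _ _ _ aD a'D h1 h1') (E _ _ _ bD b'D h2 h2') (E _ _ _ cD c'D h3 h3').
Qed.

Lemma coset_integers n t w : t \in triples n -> coset n t w ->
  [/\ w.1.1 \in Oi, w.1.2 \in Oi & w.2 \in Oi].
Proof.
have E x y : x \in digits n -> y - x \in mI n -> y \in Oi.
  by move=> /digits_Oi xO /mI_Oi yx; rewrite -[y](subrK x) rpredD.
by rewrite mem_triples => /and3P[aD bD cD] [h1 h2 h3]; split;
  [exact: E aD h1 | exact: E bD h2 | exact: E cD h3].
Qed.

Lemma integers3P w : integers3 K w <-> [/\ w.1.1 \in Oi, w.1.2 \in Oi & w.2 \in Oi].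
Proof.
by split=> -[h1 h2 h3]; split; apply/integersE.
Qed.

Lemma bigsetU_seqP (I : eqType) (s : seq I) (P : pred I) (F : I -> set K3) w :
  (\big[setU/set0]_(i <- s | P i) F i) w <-> exists2 i, i \in s & P i /\ F i w.
Proof.
elim: s => [|i s IHs]; first by rewrite big_nil; split=> // -[].
rewrite big_cons; split.
  case: ifP => [Pi [Fi|/IHs[j js jP]]|_ /IHs[j js jP]].
  - by exists i; rewrite ?mem_head.
  - by exists j; rewrite ?in_cons ?js ?orbT.
  - by exists j; rewrite ?in_cons ?js ?orbT.
move=> [j]; rewrite in_cons => /predU1P[->|js] [Pj Fj].
  by rewrite Pj; left.
have h : (\big[setU/set0]_(i <- s | P i) F i) w by apply/IHs; exists j.
by case: ifP => // _; right.
Qed.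

Lemma integers3_triples n :
  integers3 K = \big[setU/set0]_(t <- triples n) coset n t.
Proof.
apply/seteqP; split=> w.
  move=> /integers3P[xO yO zO]; apply/bigsetU_seqP.
  have [a aD ha] := digits_ex n xO; have [b bD hb] := digits_ex n yO.
  have [c cD hc] := digits_ex n zO; exists ((a, b), c) => //.
  by rewrite mem_triples aD bD.
by move=> /bigsetU_seqP[t tt [_ wt]]; apply/integers3P; apply: coset_integers wt.
Qed.

Lemma measurable_integers3 : measurable (integers3 K : set (borelK3 K)).
Proof.
by rewrite (integers3_triples 0); apply: bigsetU_measurable => t _;
  apply: measurable_coset.
Qed.

(** The [q^(3n)] cosets have equal measure by invariance and partition a set of measure 1.
    Additivity is applied to the integral of the constant 1. *)
Lemma mu_coset n t : mu (coset n t) = ((q%:R ^+ (3 * n))^-1)%:E.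
Proof.
have [inv mu1] := mu_haar.
have mu_eq u : mu (coset n u) = mu (coset n 0).
  rewrite -(inv u (coset n 0)); last exact: measurable_coset.
  congr (mu _); apply/seteqP; split=> w.
    move=> [h1 h2 h3]; exists (w - u); first by split; rewrite /= subr0.
    by rewrite addrC subrK.
  by move=> [v [/= h1 h2 h3] <-]; move: h1 h2 h3; rewrite !subr0 => h1 h2 h3;
    split; rewrite /= addrAC subrr add0r.
rewrite mu_eq.
have int1 (D : set (borelK3 K)) : measurable D ->
    (\int[mu]_(x in D) ((fun=> 1 : R) x)%:E)%E = mu D.
  by move=> mD; have := integral_cst mu mD 1%:E; rewrite mul1e.
have : (\int[mu]_(x in integers3 K) ((fun=> 1 : R) x)%:E)%E = 1%E.
  by rewrite int1 //; exact: measurable_integers3.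
rewrite {1}(integers3_triples n) integral_bigsetU_EFin.
- rewrite (eq_bigr (fun=> mu (coset n 0))) => [|u _]; last first.
    by rewrite int1 ?mu_eq //; exact: measurable_coset.
  have muF : mu (coset n 0) \is a fin_num.
    rewrite ge0_fin_numE //.
    apply: (@le_lt_trans _ _ (mu (integers3 K))); last by rewrite mu1 ltry.
    apply: le_measure; rewrite ?inE; try exact: measurable_coset.
      exact: measurable_integers3.
    by move=> w [h1 h2 h3]; move: h1 h2 h3; rewrite !subr0 => /mI_Oi h1 /mI_Oi h2
      /mI_Oi h3; apply/integers3P.
  rewrite -(fineK muF) sumEFin big_const_seq count_predT triples_size iter_addr_0.
  move=> [h]; congr (_%:E); apply: (@mulfI _ (q%:R ^+ (3 * n))).
    by rewrite expf_neq0 // pnatr_eq0 -lt0n (ltn_trans _ residue_card_gt1).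
  rewrite divff; last by rewrite expf_neq0 // pnatr_eq0 -lt0n (ltn_trans _ residue_card_gt1).
  apply: etrans h; rewrite -[RHS]mulr_natl !natrM !natrX -!exprD.
  by congr (_ ^+ _ * _); lia.
- by move=> i; apply: measurable_coset.
- exact: triples_uniq.
- exact: triples_trivIset.
- exact: measurable_cst.
Qed.

Definition step (V : Type) n (H : K3 -> V) :=
  forall t w, t \in triples n -> coset n t w -> H w = H t.

Let D : set (borelK3 K) := integers3 K.

Lemma measurable_step n (H : K3 -> R) : step n H ->
  measurable_fun D (H : borelK3 K -> R).
Proof.
move=> Hn _ Y mY.
have -> : D `&` (H : borelK3 K -> R) @^-1` Y =
    \big[setU/set0]_(t <- triples n | H t \in Y) coset n t.
  apply/seteqP; split=> w.
    rewrite {1}/D (integers3_triples n) => -[/bigsetU_seqP[t tt [_ wt]] /= Hw].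
    apply/bigsetU_seqP; exists t => //; split => //.
    by rewrite -(Hn t w) // inE.
  move=> /bigsetU_seqP[t tt [/set_mem HY wt]]; split.
    by rewrite /D (integers3_triples n); apply/bigsetU_seqP; exists t.
  by rewrite /= (Hn t w).
by apply: bigsetU_measurable => t _; apply: measurable_coset.
Qed.

Lemma Rintegral_step n (H : K3 -> R) : step n H ->
  \int[mu]_(w in D) (H w) = (q%:R ^+ (3 * n))^-1 * \sum_(t <- triples n) H t.
Proof.
move=> Hn; have mH := measurable_step Hn.
rewrite /Rintegral /D (integers3_triples n) integral_bigsetU_EFin.
- rewrite (eq_big_seq (fun t => (H t * (q%:R ^+ (3 * n))^-1)%:E)).
    by rewrite sumEFin /= -mulr_suml mulrC.
  move=> t tt; rewrite EFinM -(mu_coset n t).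
  rewrite -(integral_cst mu (measurable_coset n t)).
  by apply: eq_integral => w; rewrite inE => wt; rewrite (Hn t w).
- by move=> i; apply: measurable_coset.
- exact: triples_uniq.
- exact: triples_trivIset.
- by rewrite -(integers3_triples n); apply/measurable_EFinP.
Qed.

Lemma step_bounded n (H : K3 -> R) : step n H ->
  forall w, D w -> `|H w| <= \sum_(t <- triples n) `|H t|.
Proof.
move=> Hn w; rewrite {1}/D (integers3_triples n) => /bigsetU_seqP[t tt [_ wt]].
by rewrite (Hn t w) // (bigD1_seq t) ?triples_uniq //= lerDl sumr_ge0.
Qed.

Lemma mu_D : mu D = 1%E. Proof. by case: mu_haar. Qed.

Lemma integrable_bounded (g : K3 -> R) b :
  measurable_fun D (g : borelK3 K -> R) -> (forall w, D w -> `|g w| <= b) ->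
  mu.-integrable D (EFin \o (g : borelK3 K -> R)).
Proof.
move=> mg gb; apply: measurable_bounded_integrable => //.
- exact: measurable_integers3.
- by rewrite mu_D ltry.
- exists b; split; first exact: num_real.
  by move=> x bx w /= Dw; apply: le_trans (gb w Dw) (ltW bx).
Qed.

Section UniformApproximation.
Variables (lev : nat -> nat) (c : nat -> R).
Hypothesis c0 : c n @[n --> \oo] --> (0 : R).

(** [g] is measurable as a limit of step functions and bounded because [H 0] is, hence integrable.
    Integrating the uniform bound over a set of mass 1 gives the estimate. *)
Lemma Rintegral_approx (g : K3 -> R) (H : nat -> K3 -> R) :
  (forall n, step (lev n) (H n)) ->
  (forall n w, D w -> `|g w - H n w| <= c n) -> forall n,
  `|\int[mu]_(w in D) (g w) -
    (q%:R ^+ (3 * lev n))^-1 * \sum_(t <- triples (lev n)) H n t| <= c n.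
Proof.
move=> Hs gH n.
have mH i := measurable_step (Hs i).
have mg : measurable_fun D (g : borelK3 K -> R).
  apply: (@measurable_fun_cvg _ (borelK3 K) R D H g) => // w Dw.
  apply/cvgrPdist_le => e e0; move/cvgrPdist_le: c0 => /(_ e e0).
  apply: filterS => i; rewrite sub0r normrN => ci.
  by apply: le_trans (gH i w Dw) (le_trans (ler_norm _) ci).
have Hb i := step_bounded (Hs i).
have ig : mu.-integrable D (EFin \o (g : borelK3 K -> R)).
  apply: (integrable_bounded (b := c 0%N + \sum_(t <- triples (lev 0%N)) `|H 0%N t|)) => // w Dw.
  rewrite -[g w](subrK (H 0%N w)); apply: le_trans (ler_normD _ _) _.
  by rewrite lerD ?gH ?Hb.
have iH : mu.-integrable D (EFin \o (H n : borelK3 K -> R)).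
  exact: integrable_bounded (mH n) (Hb n).
have mD : measurable D by exact: measurable_integers3.
rewrite -Rintegral_step // -RintegralB //.
have mgH : measurable_fun D (fun w : borelK3 K => g w - H n w).
  exact: measurable_funB.
have igH : mu.-integrable D (EFin \o (fun w : borelK3 K => g w - H n w)).
  exact: integrable_bounded (gH n).
apply: le_trans (le_normr_Rintegral _ _) _ => //.
have cE : \int[mu]_(w in D) (c n) = c n by rewrite Rintegral_cst // mu_D mulr1.
rewrite -[leRHS]cE; apply: le_Rintegral => //.
- apply: (integrable_bounded (b := c n)); first exact: measurableT_comp.
  by move=> w Dw; rewrite normr_id gH.
- apply: (integrable_bounded (b := `|c n|)) => //.
- by move=> w Dw; apply: gH.
Qed.

Lemma normc_i : `|'i%C : C| = 1.
Proof. by rewrite normc_def /= expr0n expr1n add0r sqrtr1. Qed.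

Lemma normc_realE (a : R) : `|a%:C%C : C| = `|a|%:C%C.
Proof. by rewrite normc_def /= expr0n addr0 sqrtr_sqr. Qed.

Lemma normc_ge_Im (z : C) : `|complex.Im z|%:C%C <= `|z|.
Proof.
have -> : `|z| = `|z * 'i%C| by rewrite normrM normc_i mulr1.
by apply: le_trans (normc_ge_Re _); rewrite ReiNIm normrN.
Qed.

Lemma normc_le_ReIm (a b : R) : `|Complex a b| <= (`|a| + `|b|)%:C%C.
Proof.
rewrite [Complex a b]complexE /=; apply: le_trans (ler_normD _ _) _.
by rewrite normrM normc_i mul1r !normc_realE rmorphD.
Qed.

(** Real and imaginary parts are estimated separately, whence the factor 2. *)
Lemma Cintegral_approx (g : K3 -> C) (H : nat -> K3 -> C) :
  (forall n, step (lev n) (H n)) ->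
  (forall n w, D w -> `|g w - H n w| <= (c n)%:C%C) -> forall n,
  `|Cintegral mu D g -
    (q%:R ^+ (3 * lev n))^-1 * \sum_(t <- triples (lev n)) H n t|
  <= (c n *+ 2)%:C%C.
Proof.
move=> Hs gH n.
have hR := @Rintegral_approx (fun w => complex.Re (g w)) (fun n w => complex.Re (H n w)).
have hI := @Rintegral_approx (fun w => complex.Im (g w)) (fun n w => complex.Im (H n w)).
have {}hR := hR _ _ n; have {}hI := hI _ _ n.
set S := \sum_(t <- triples (lev n)) H n t.
have -> : (q%:R ^+ (3 * lev n))^-1 * S =
  Complex ((q%:R ^+ (3 * lev n))^-1 * \sum_(t <- triples (lev n)) complex.Re (H n t))
          ((q%:R ^+ (3 * lev n))^-1 * \sum_(t <- triples (lev n)) complex.Im (H n t)).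
  have -> : (q%:R ^+ (3 * lev n))^-1 = ((q%:R ^+ (3 * lev n))^-1 : R)%:C%C :> C.
    by rewrite fmorphV rmorphXn rmorph_nat.
  have -> : S = Complex (\sum_(t <- triples (lev n)) complex.Re (H n t))
                        (\sum_(t <- triples (lev n)) complex.Im (H n t)).
    rewrite /S; elim: (triples (lev n)) => [|t s IHs]; first by rewrite !big_nil.
    by rewrite !big_cons IHs; case: (H n t).
  by apply/eqP; rewrite eq_complex /= !mul0r subr0 addr0 !eqxx.
rewrite /Cintegral.
have E (x y z t : R) : Complex x y - Complex z t = Complex (x - z) (y - t) by [].
rewrite E; apply: le_trans (normc_le_ReIm _ _) _.
rewrite lecR mulr2n lerD //.
- apply: hR => [i t w tt wt|i w Dw]; first by rewrite (Hs i t w).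
  rewrite -lecR; apply: le_trans (gH i w Dw).
  by apply: le_trans (normc_ge_Re _); rewrite raddfB.
- apply: hI => [i t w tt wt|i w Dw]; first by rewrite (Hs i t w).
  rewrite -lecR; apply: le_trans (gH i w Dw).
  by apply: le_trans (normc_ge_Im _); rewrite raddfB.
Qed.
End UniformApproximation.

Lemma avg3_triples n (H : K -> K -> K -> C) :
  avg n (fun z => avg n (fun x => avg n (fun y => H x y z))) =
  (q%:R ^+ (3 * n))^-1 * \sum_(t <- triples n) H t.1.1 t.1.2 t.2.
Proof.
rewrite /triples big_allpairs_dep /=.
under [in RHS]eq_bigr do rewrite big_allpairs_dep /=.
rewrite [in RHS](_ : 3 * n = n + (n + n))%N; last by lia.
rewrite !exprD !invfM -!mulrA /avg; congr (_ * _); rewrite !mulr_sumr.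
apply: eq_bigr => z _; congr (_ * _); rewrite mulr_sumr.
by apply: eq_bigr.
Qed.

Lemma integrandE (f : K) s m : f != 0 -> ord f = m%:Z ->
  chi_ac pi chi f * powC (absK R f) s = phi m f * powC (q%:R : R) (- s) ^+ m.
Proof.
move=> f0 fm; rewrite /chi_ac /absK /ac /phi (negPf f0) fm eqxx /=; congr (_ * _).
have q0 : (q%:R : R) != 0 by rewrite pnatr_eq0 -lt0n ltnW ?residue_card_gt1.
have qp : 0 < (q%:R : R) by rewrite ltr0n ltnW ?residue_card_gt1.
rewrite -invr_expz -exprnP /powC invr_eq0 expf_eq0 (negPf q0) andbF.
rewrite lnV ?posrE ?exprn_gt0 // lnXn // -expCMn; congr expC.
by rewrite rmorphN rmorphMn /=; ring.
Qed.

(** The truncation [H n] is constant on cosets of level [n + M], because it involves only [phi m]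
    with [m < n]. It differs from the integrand only where [f] is nonzero of order at least [n], and
    there the integrand is at most [B |T|^n]. *)
Lemma zeta_approx (f : K -> K -> K -> K) s : cp3 f -> 0 < complex.Re s ->
  exists b : C, forall n, `|zeta3 mu pi f chi s -
    \sum_(m < n) A3 m f * powC (q%:R : R) (- s) ^+ m|
    <= b * `|powC (q%:R : R) (- s)| ^+ n.
Proof.
move=> cpf s0; set T := powC _ _.
have T1 : `|T| < 1 by apply: norm_powC_lt1 => //; apply: residue_card_gt1.
have toR (x : C) : 0 <= x -> x = (complex.Re x)%:C%C.
  by move=> x0; rewrite RRe_real // ger0_real.
have B0 : 0 <= B by apply: le_trans (chiB (rpred1 _)).
pose rho := complex.Re `|T|; have TE : `|T| = rho%:C%C by apply: toR.
pose b := complex.Re B; have BE : B = b%:C%C by apply: toR.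
have rho1 : `|rho| < 1.
  have := T1; rewrite TE [ltRHS](_ : 1 = (1 : R)%:C%C) // ltcR => rho1.
  by rewrite ger0_norm //; have := normr_ge0 T; rewrite TE lecR.
pose H n (w : K3) := \sum_(m < n) phi m (f w.1.1 w.1.2 w.2) * T ^+ m.
pose g (w : K3) := chi_ac pi chi (f w.1.1 w.1.2 w.2) *
  powC (absK R (f w.1.1 w.1.2 w.2)) s.
have geoE n : (geometric b rho n)%:C%C = B * `|T| ^+ n.
  by rewrite [in RHS]BE TE -rmorphXn -rmorphM.
have c0 : geometric b rho n @[n --> \oo] --> (0 : R) by apply: cvg_geometric.
have Hs n : step (n + M) (H n).
  move=> t w tt wt; apply: eq_bigr => m _; congr (_ * _); apply: phi_congr.
  have [wx wy wz] := coset_integers tt wt.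
  move: tt; rewrite mem_triples => /and3P[/digits_Oi tx /digits_Oi ty /digits_Oi tz].
  case: wt => hx hy hz; apply: (@mI_le _ (n + M)); first by rewrite leq_add2r ltnW.
  by apply: eqm_mI; apply: cpf; apply/and3P.
have gH n w : integers3 K w -> `|g w - H n w| <= (geometric b rho n)%:C%C.
  move=> /integers3P[wx wy wz]; rewrite geoE.
  rewrite /g /H; set v := f _ _ _.
  have vO : v \in Oi.
    by apply: (@eqm_Oil 0 _ v); apply: cpf; apply: eqm_refl.
  have bnd0 : 0 <= B * `|T| ^+ n by rewrite mulr_ge0 ?exprn_ge0.
  have [v0|v0] := eqVneq v 0.
    rewrite /chi_ac v0 eqxx mul0r sub0r normrN big1 ?normr0 // => m _.
    by rewrite /phi eqxx mul0r.
  have [m vm] : exists m : nat, ord v = m%:Z.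
    move: vO; rewrite inE (negPf v0) /=; case: (ord v) => // m _.
    by exists m.
  have phi0 i : i != m -> phi i v = 0.
    by move=> im; rewrite /phi v0 vm eqz_nat eq_sym (negPf im).
  rewrite (integrandE s v0 vm) -/T.
  have [mn|nm] := ltnP m n.
    rewrite (bigD1 (Ordinal mn)) //= big1 ?addr0 ?subrr ?normr0 // => i im.
    by rewrite phi0 ?mul0r.
  rewrite big1 ?subr0 => [|i _]; last first.
    by rewrite phi0 ?mul0r // ltn_eqF // (leq_trans (ltn_ord i)).
  rewrite normrM normrX ler_pM ?exprn_ge0 ?phi_norm //.
  by rewrite -(subnK nm) exprD ler_piMl ?exprn_ge0 // exprn_ile1 // ltW.
exists (B *+ 2) => n.
have := Cintegral_approx c0 Hs gH n.
have -> : (geometric b rho n *+ 2)%:C%C = B *+ 2 * `|T| ^+ n.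
  by rewrite mulrnAl -geoE rmorphMn.
apply: le_trans; rewrite le_eqVlt; apply/orP; left; apply/eqP.
congr (`|_ - _|).
rewrite -(avg3_triples (n + M) (fun x y z => \sum_(m < n) phi m (f x y z) * T ^+ m)).
have avgE N (G : 'I_n -> K -> C) : avg N (fun x => \sum_(m < n) G m x * T ^+ m) =
    \sum_(m < n) avg N (G m) * T ^+ m.
  by rewrite avg_sum; apply: eq_bigr => m _; rewrite avgZr.
symmetry; transitivity (avg (n + M) (fun z => \sum_(m < n) avg (n + M) (fun x => avg (n + M)
    (fun y => phi m (f x y z))) * T ^+ m)); last first.
  rewrite avgE; apply: eq_bigr => m _; congr (_ * _).
  have mn : (m + M <= n + M)%N by rewrite leq_add2r ltnW.
  rewrite /A3 -(avg_lift mn (A2_inv cpf)); apply: eq_avg => z zO.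
  have cpz := cp3_2 cpf zO.
  rewrite /A2 -(avg_lift mn (A1_inv cpz)); apply: eq_avg => x xO.
  by rewrite -(A1_lift (cp2_r cpz xO) mn).
by apply: eq_avg => z _; rewrite -avgE; apply: eq_avg => x _; exact: avgE.
Qed.

Lemma zeta_of_gf Q P (f : K -> K -> K -> K) s :
  cp3 f -> gf Q P (fun m => A3 m f) -> 0 < complex.Re s ->
  Q.[powC (q%:R : R) (- s)] * zeta3 mu pi f chi s = P.[powC (q%:R : R) (- s)].
Proof.
move=> cpf hgf s0; have [b hb] := zeta_approx cpf s0.
set T := powC _ _ in hb *.
have T1 : `|T| < 1 by apply: norm_powC_lt1 => //; apply: residue_card_gt1.
have [b' hb'] := hgf T T1.
apply/eqP; rewrite -subr_eq0; apply/eqP.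
apply: (eq0_of_geometric_bound (B := `|Q.[T]| * b + b') T1) => n.
have -> : Q.[T] * zeta3 mu pi f chi s - P.[T] =
   Q.[T] * (zeta3 mu pi f chi s - \sum_(m < n) A3 m f * T ^+ m) +
   (Q.[T] * (\sum_(m < n) A3 m f * T ^+ m) - P.[T]) by ring.
apply: le_trans (ler_normD _ _) _; rewrite mulrDl lerD ?hb' //.
by rewrite normrM -mulrA ler_wpM2l ?hb.
Qed.
End HaarMeasure.
End LevelSets.

Lemma den_factor_neq0 j m (T : C) : (0 < j)%N -> `|T| < 1 ->
  1 - (q%:R ^+ j)^-1 * T ^+ m != 0.
Proof.
move=> j0 T1; rewrite subr_eq0 eq_sym; apply/negP => /eqP e.
have : `|(q%:R ^+ j)^-1 * T ^+ m| < 1.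
  rewrite normrM normfV !normrX normr_nat mulrC ltr_pdivrMr; last first.
    by rewrite exprn_gt0 // ltr0n ltnW ?residue_card_gt1.
  rewrite mul1r; apply: (@le_lt_trans _ _ 1).
    by rewrite exprn_ile1 // ltW.
  by rewrite exprn_egt1 ?ltr1n ?residue_card_gt1 // -lt0n.
by rewrite e normr1 ltxx.
Qed.
End Averages.
End Ideals.
End ValuationRing.

(** * Rational expressions for the zeta function *)

Unset Implicit Arguments.

Theorem theorem1p2 (R : realType) (K : localFieldType) (p : nat)
    (charK : p \in [pchar K]) (pi : K) (pi_unif : uniformizer pi)
    (mu : {measure set (borelK3 K) -> \bar R}) (mu_haar : normalized_haar mu)
    (k r l : nat) (k_gt0 : (0 < k)%N) (r_gt0 : (0 < r)%N) (l_gt0 : (0 < l)%N)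
    (p_ndvd_rl : ~~ (p %| r * l)%N) (p_dvd_rlk : (p %| r + l + k)%N)
    (residues_le : (r %% p + l %% p <= p)%N)
    (t : K) (t_root : exists tau : K, units K tau /\ tau ^+ p = t)
    (chi : K -> R[i]) (chi_char : mult_char chi) :
  let q : R := (residue_card K)%:R in
  let Z : R[i] -> R[i] := zeta3 mu pi (hybrid p k r l t) chi in
  rational_in_powC q Z /\
  ((p %| 'C(k + r, r))%N ->
     forall s : R[i], 0 < complex.Re s ->
       ((forall u : K, units K u -> chi u ^+ p = 1) ->
          Z s = (1 - powC q (- 1)) / (1 - powC q (- 1 - p%:R * s))) /\
       (~ (forall u : K, units K u -> chi u ^+ p = 1) -> Z s = 0)) /\
  (~~ (p %| 'C(k + r, r))%N ->
     exists F : {poly R[i]}, forall s : R[i], 0 < complex.Re s ->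
       Z s = F.[powC q (- s)] /
         ((1 - powC q (- 1 - s)) *
          (1 - powC q (- ((k + l + r) %/ p + 2)%:R - (k + l + r)%:R * s)) *
          \prod_(a <- undup [:: r; l; k.+1])
             (1 - powC q (- p%:R - a%:R - p%:R * a%:R * s)))).
Proof.
move=> q Z.
have q1 := residue_card_gt1 pi_unif.
have [tau [/unitsE tau_u tE]] := t_root.
have [M M_gt0 chiM] := chi_locally_trivial pi_unif chi_char.
have [B chiB] := chi_bounded pi_unif chi_char.
have pp := pcharf_prime charK; have p_gt0 := prime_gt0 pp.
have tO : t \in @Oi K by rewrite -tE rpredX // uO_Oi.
set c := fun m => A3 pi chi M m (hybrid p k r l t).
(* The value of [chi] at the unit by which the reduction to [t = 1] multiplies the polynomial. *)
set N := chi (tau ^+ p ^+ (k + r)).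
have cE : (fun m => N * A3 pi chi M m (hybrid p k r l 1)) =1 c.
  by move=> m; rewrite /c -tE A3_hybrid_t.
have T1 s : 0 < complex.Re s -> `|powC q (- s)| < 1 by apply: norm_powC_lt1.
have zetaE Q P s : gf Q P c -> 0 < complex.Re s ->
    Q.[powC q (- s)] * Z s = P.[powC q (- s)].
  move=> hgf s0; apply: (zeta_of_gf pi_unif chi_char M_gt0 chiM chiB mu_haar _ hgf s0).
  exact: hybrid_cp3.
have [pb|pb] := boolP (p %| 'C(k + r, r))%N.
  pose Q : {poly R[i]} := 1 - (residue_card K)%:R^-1 *: 'X^p.
  pose kap := A1 pi chi M 0 (fun x => x ^+ p).
  have hgf : gf Q (N *: kap%:P) c.
    apply: gf_ext cE _; apply: gf_scale.
    exact: (degenerate_gf pi_unif chi_char M_gt0 chiM chiB charK).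
  have Q0 s : 0 < complex.Re s -> Q.[powC q (- s)] != 0.
    move=> /T1 h; rewrite hornerD hornerN hornerZ hornerXn hornerC.
    exact: (den_factor_neq0 pi_unif (j := 1)).
  have ZE s : 0 < complex.Re s -> Z s = N * kap / Q.[powC q (- s)].
    move=> s0; have := zetaE _ _ s hgf s0; rewrite hornerZ hornerC => <-.
    by rewrite mulrC mulKf ?Q0.
  split; last split => // _ s s0.
    exists (N * kap)%:P, Q => s s0; split; first exact: Q0.
    by rewrite ZE // hornerC.
  split=> [chip|nchip].
    have chip' u : u \in @uO K -> chi u ^+ p = 1 by move=> /unitsE; apply: chip.
    (* That unit is the [p]-th power of [tau^(k+r)], so [N] disappears when [chi^p] is trivial;
       otherwise [kap] is 0. *)
    have N1 : N = 1 by rewrite /N exprAC chi_X ?rpredX // chip' ?rpredX.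
    have := powC_monomial (R := R) 1 p s q1; rewrite expr1 => ->.
    have := powC_monomial (R := R) 1 0 s q1; rewrite expr1 expr0 mulr1 mul0r subr0 => ->.
    rewrite ZE // N1 mul1r /kap (A1_pow_trivial pi_unif chi_char M_gt0 charK) //.
    by rewrite hornerD hornerN hornerZ hornerXn hornerC.
  have [u [uu chiu]] : exists u, units K u /\ chi u ^+ p <> 1.
    by move: nchip => /existsNP[u /not_implyP[? ?]]; exists u.
  rewrite ZE // /kap (A1_pow_nontrivial pi_unif chi_char M_gt0 chiM (u := u)) //.
  - by rewrite mulr0 mul0r.
  - exact/unitsE.
  - exact/eqP.
have [p_ndvd_r p_ndvd_l] : ~~ (p %| r)%N /\ ~~ (p %| l)%N.
  by apply/andP; rewrite -negb_or -Euclid_dvdM.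
pose Q : {poly R[i]} := hybrid_den K R p k r l.
have [P hgf] : gfE Q c.
  apply: gfE_ext cE _; apply: gfE_scale.
  exact: (nondegenerate_gf pi_unif chi_char M_gt0 chiM chiB charK).
have QE s : Q.[powC q (- s)] = (1 - powC q (- 1 - s)) *
    (1 - powC q (- ((k + l + r) %/ p + 2)%:R - (k + l + r)%:R * s)) *
    \prod_(a <- undup [:: r; l; k.+1]) (1 - powC q (- p%:R - a%:R - p%:R * a%:R * s)).
  have fac j m : (1 - ((residue_card K)%:R ^+ j)^-1 *: 'X^m).[powC q (- s)] =
      1 - powC q (- j%:R - m%:R * s).
    by rewrite powC_monomial // hornerD hornerN hornerZ hornerXn hornerC.
  rewrite /Q /hybrid_den !hornerM horner_prod fac.
  have := fac 1%N 1%N; rewrite expr1 mul1r => ->.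
  rewrite (_ : r + l + k = k + l + r)%N; last by lia.
  congr (_ * _); apply: eq_bigr => a _.
  by rewrite fac natrD natrM opprD.
have Q0 s : 0 < complex.Re s -> Q.[powC q (- s)] != 0.
  move=> /T1 h.
  have fac j m : (0 < j)%N ->
      (1 - ((residue_card K)%:R ^+ j)^-1 *: 'X^m).[powC q (- s)] != 0.
    move=> j0; rewrite hornerD hornerN hornerZ hornerXn hornerC.
    exact: (den_factor_neq0 pi_unif).
  rewrite /Q /hybrid_den !hornerM horner_prod !mulf_neq0 //.
  - by have := fac 1%N 1%N isT; rewrite expr1.
  - by apply: fac; rewrite addn2.
  - by rewrite prodf_seq_neq0; apply/allP => a _; apply: fac; rewrite addn_gt0 p_gt0.
have ZE s : 0 < complex.Re s -> Z s = P.[powC q (- s)] / Q.[powC q (- s)].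
  by move=> s0; rewrite -(zetaE _ _ s hgf s0) mulrC mulKf ?Q0.
split; last split => // _.
  by exists P, Q => s s0; split; [exact: Q0 | exact: ZE].
by exists P => s s0; rewrite ZE // QE.
Qed.
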